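(* Let $G$ be a finite group. Then there is a canonical identification $$C^*_{\mathrm{par}}(G)\cong\bigoplus_{n=1}^{|G|}\ \bigoplus_{z\in\mathcal{O}_n(G)}M_{m_z+1}(C^*(H_z)).$$
   Context: $C^*_{\mathrm{par}}(G)$ is the partial group $C^*$-algebra of $G$: the universal unital $C^*$-algebra generated by elements $[g]$, $g\in G$, subject to $[1]=1$, $[g^{-1}]=[g]^*$ and $[g][h][h^{-1}]=[gh][h^{-1}]$ for all $g,h\in G$. For $1\le n\le|G|$ let $\mathcal{T}_n(G)=\{\tau\subseteq G\colon 1\in\tau,\ |\tau|=n\}$. $G$ acts partially on $\mathcal{T}_n(G)$ by left translation, $g$ sending $\tau$ to $g\tau$ whenever $g^{-1}\in\tau$. Let $\mathcal{O}_n(G)$ be the orbit space, so two tuples $\tau,\tau'$ are in the same orbit if and only if $\tau'=g\tau$ for some $g\in G$ with $g^{-1}\in\tau$. For each $z\in\mathcal{O}_n(G)$ fix a representative $\tau_z\in\mathcal{T}_n(G)$ of $z$, and set $H_z=\{h\in G\colon h\tau_z=\tau_z\}$ (a finite subgroup of $G$ whose order divides $n$) and $m_z=\frac{n}{|H_z|}-1$. $C^*(H_z)$ denotes the group $C^*$-algebra. *)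

(* Defs.v *)
From HB Require Import structures.
From mathcomp Require Import all_boot all_order all_fingroup all_algebra complex.
From mathcomp Require Import reals.

Set Implicit Arguments.
Unset Strict Implicit.
Unset Printing Implicit Defensive.

Import Order.TTheory GRing.Theory Num.Theory.

Local Open Scope ring_scope.
Local Open Scope complex_scope.

HB.mixin Record isStarAlgebra (R : realType) A & GRing.Algebra R[i] A := {
  star : A -> A;
  starK : involutive star;
  starD : {morph star : x y / x + y};
  starZ : forall (k : R[i]) (x : A), star (k *: x) = k^* *: star x;
  starM : forall x y : A, star (x * y) = star y * star x
}.

(* As for every algType, 1 != 0 is part of the structure. *)
#[short(type="starAlgType")]
HB.structure Definition StarAlgebra (R : realType) :=
  {A of GRing.Algebra R[i] A & isStarAlgebra R A}.

(* The norm is a separate operation: MathComp has no structure joining rings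
   and normed modules below numDomainType, so normedModType cannot be used. *)
HB.mixin Record StarAlgebra_isCStar (R : realType) A & StarAlgebra R A := {
  cnorm : A -> R;
  cnorm0_eq0 : forall x : A, cnorm x = 0 -> x = 0;
  cnormD : forall x y : A, cnorm (x + y) <= cnorm x + cnorm y;
  cnormZ : forall (k : R[i]) (x : A),
    (cnorm (k *: x))%:C = `|k| * (cnorm x)%:C;
  cnormM : forall x y : A, cnorm (x * y) <= cnorm x * cnorm y;
  cnorm_star : forall x : A, cnorm (star x * x) = cnorm x ^+ 2;
  cnorm_complete : forall a : nat -> A,
    (forall e : R, 0 < e -> exists N : nat, forall m n : nat,
       (N <= m)%N -> (N <= n)%N -> cnorm (a m - a n) < e) ->
    exists l : A, forall e : R, 0 < e -> exists N : nat, forall n : nat,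
       (N <= n)%N -> cnorm (a n - l) < e
}.

#[short(type="cstarAlgType")]
HB.structure Definition CStarAlgebra (R : realType) :=
  {A of StarAlgebra R A & StarAlgebra_isCStar R A}.

Definition star_hom (R : realType) (A B : starAlgType R) (f : A -> B) : Prop :=
  [/\ linear f, monoid_morphism f & {morph f : x / star x}].

(* A C*-norm on a *-algebra is unique, and a bijective *-homomorphism between
   C*-algebras is isometric, so isomorphisms of C*-algebras are the
   isomorphisms of the underlying *-algebras. *)
Definition star_iso (R : realType) (A B : starAlgType R) (f : A -> B) : Prop :=
  star_hom f /\ bijective f.

Section Matrix.
Variables (R : realType) (A : starAlgType R) (k : nat).

(* 'M[A]_k carries the scaling by A; this alias carries the scaling by R[i]. *)
Definition starmx : Type := 'M[A]_k.+1.

HB.instance Definition _ := GRing.NzRing.on starmx.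

Definition starmx_scale (c : R[i]) (M : starmx) : starmx :=
  map_mx (fun a : A => c *: a) M.

Definition starmx_star (M : starmx) : starmx := map_mx (fun a : A => star a) M^T.

Fact starmx_scaleA c d M :
  starmx_scale c (starmx_scale d M) = starmx_scale (c * d) M.
Proof. by apply/matrixP => i j; rewrite !mxE scalerA. Qed.

Fact starmx_scale1 : left_id 1 starmx_scale.
Proof. by move=> M; apply/matrixP => i j; rewrite !mxE scale1r. Qed.

Fact starmx_scaleDr : right_distributive starmx_scale +%R.
Proof. by move=> c M N; apply/matrixP => i j; rewrite !mxE scalerDr. Qed.

Fact starmx_scaleDl M : {morph starmx_scale^~ M : c d / c + d}.
Proof. by move=> c d; apply/matrixP => i j; rewrite !mxE scalerDl. Qed.

HB.instance Definition _ := GRing.Zmodule_isLmodule.Build R[i] starmx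
  starmx_scaleA starmx_scale1 starmx_scaleDr starmx_scaleDl.

Fact starmx_scaleAl (c : R[i]) (M N : starmx) : c *: (M * N) = (c *: M) * N.
Proof.
apply/matrixP => i j; rewrite !mxE scaler_sumr.
by apply: eq_bigr => l _; rewrite !mxE scalerAl.
Qed.

HB.instance Definition _ := GRing.Lmodule_isLalgebra.Build R[i] starmx
  starmx_scaleAl.

Fact starmx_scaleAr (c : R[i]) (M N : starmx) : c *: (M * N) = M * (c *: N).
Proof.
apply/matrixP => i j; rewrite !mxE scaler_sumr.
by apply: eq_bigr => l _; rewrite !mxE scalerAr.
Qed.

HB.instance Definition _ := GRing.Lalgebra_isAlgebra.Build R[i] starmx
  starmx_scaleAr.

Fact starmx_starK : involutive starmx_star.
Proof. by move=> M; apply/matrixP => i j; rewrite !mxE starK. Qed.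

Fact starmx_starD : {morph starmx_star : M N / M + N}.
Proof. by move=> M N; apply/matrixP => i j; rewrite !mxE starD. Qed.

Fact starmx_starZ (c : R[i]) (M : starmx) :
  starmx_star (c *: M) = c^* *: starmx_star M.
Proof. by apply/matrixP => i j; rewrite !mxE starZ. Qed.

Fact starmx_starM (M N : starmx) :
  starmx_star (M * N) = starmx_star N * starmx_star M.
Proof.
have star0 : star (0 : A) = 0.
  by apply: (addrI (star 0)); rewrite -starD !addr0.
apply/matrixP => i j; rewrite !mxE (big_morph _ (@starD _ A) star0).
by apply: eq_bigr => l _; rewrite !mxE starM.
Qed.

HB.instance Definition _ := isStarAlgebra.Build R starmx
  starmx_starK starmx_starD starmx_starZ starmx_starM.

End Matrix.

(* The direct sum of finitely many *-algebras, with componentwise operations;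
   nonemptiness of the index set gives 1 != 0. *)
Definition dsum (R : realType) (I : finType) (I_gt0 : (0 < #|I|)%N)
  (B : I -> starAlgType R) : Type := {dffun forall i : I, B i}.

Section DirectSum.
Variables (R : realType) (I : finType) (I_gt0 : (0 < #|I|)%N).
Variable B : I -> starAlgType R.

Local Notation D := (dsum I_gt0 B).

HB.instance Definition _ := Choice.on D.

Definition dsum_zero : D := [ffun i => 0 : B i].
Definition dsum_opp (a : D) : D := [ffun i => - a i].
Definition dsum_add (a b : D) : D := [ffun i => a i + b i].
Definition dsum_one : D := [ffun i => 1 : B i].
Definition dsum_mul (a b : D) : D := [ffun i => a i * b i].
Definition dsum_scale (c : R[i]) (a : D) : D := [ffun i => c *: a i].
Definition dsum_star (a : D) : D := [ffun i => star (a i)].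

Fact dsum_addA : associative dsum_add.
Proof. by move=> a b c; apply/ffunP => i; rewrite !ffunE addrA. Qed.
Fact dsum_addC : commutative dsum_add.
Proof. by move=> a b; apply/ffunP => i; rewrite !ffunE addrC. Qed.
Fact dsum_add0 : left_id dsum_zero dsum_add.
Proof. by move=> a; apply/ffunP => i; rewrite !ffunE add0r. Qed.
Fact dsum_addN : left_inverse dsum_zero dsum_opp dsum_add.
Proof. by move=> a; apply/ffunP => i; rewrite !ffunE addNr. Qed.

HB.instance Definition _ := GRing.isZmodule.Build D
  dsum_addA dsum_addC dsum_add0 dsum_addN.

Fact dsum_mulA : associative dsum_mul.
Proof. by move=> a b c; apply/ffunP => i; rewrite !ffunE mulrA. Qed.
Fact dsum_mul1l : left_id dsum_one dsum_mul.
Proof. by move=> a; apply/ffunP => i; rewrite !ffunE mul1r. Qed.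
Fact dsum_mul1r : right_id dsum_one dsum_mul.
Proof. by move=> a; apply/ffunP => i; rewrite !ffunE mulr1. Qed.
Fact dsum_mulDl : left_distributive dsum_mul dsum_add.
Proof. by move=> a b c; apply/ffunP => i; rewrite !ffunE mulrDl. Qed.
Fact dsum_mulDr : right_distributive dsum_mul dsum_add.
Proof. by move=> a b c; apply/ffunP => i; rewrite !ffunE mulrDr. Qed.
Fact dsum_one_neq0 : dsum_one != 0.
Proof.
case/card_gt0P: (I_gt0) => i _; apply/eqP => /ffunP/(_ i).
by rewrite !ffunE => /eqP; rewrite oner_eq0.
Qed.

HB.instance Definition _ := GRing.Zmodule_isNzRing.Build D
  dsum_mulA dsum_mul1l dsum_mul1r dsum_mulDl dsum_mulDr dsum_one_neq0.

Fact dsum_scaleA c d a : dsum_scale c (dsum_scale d a) = dsum_scale (c * d) a.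
Proof. by apply/ffunP => i; rewrite !ffunE scalerA. Qed.
Fact dsum_scale1 : left_id 1 dsum_scale.
Proof. by move=> a; apply/ffunP => i; rewrite !ffunE scale1r. Qed.
Fact dsum_scaleDr : right_distributive dsum_scale +%R.
Proof. by move=> c a b; apply/ffunP => i; rewrite !ffunE scalerDr. Qed.
Fact dsum_scaleDl a : {morph dsum_scale^~ a : c d / c + d}.
Proof. by move=> c d; apply/ffunP => i; rewrite !ffunE scalerDl. Qed.

HB.instance Definition _ := GRing.Zmodule_isLmodule.Build R[i] D
  dsum_scaleA dsum_scale1 dsum_scaleDr dsum_scaleDl.

Fact dsum_scaleAl (c : R[i]) (a b : D) : c *: (a * b) = (c *: a) * b.
Proof. by apply/ffunP => i; rewrite !ffunE scalerAl. Qed.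

HB.instance Definition _ := GRing.Lmodule_isLalgebra.Build R[i] D dsum_scaleAl.

Fact dsum_scaleAr (c : R[i]) (a b : D) : c *: (a * b) = a * (c *: b).
Proof. by apply/ffunP => i; rewrite !ffunE scalerAr. Qed.

HB.instance Definition _ := GRing.Lalgebra_isAlgebra.Build R[i] D dsum_scaleAr.

Fact dsum_starK : involutive dsum_star.
Proof. by move=> a; apply/ffunP => i; rewrite !ffunE starK. Qed.
Fact dsum_starD : {morph dsum_star : a b / a + b}.
Proof. by move=> a b; apply/ffunP => i; rewrite !ffunE starD. Qed.
Fact dsum_starZ (c : R[i]) (a : D) : dsum_star (c *: a) = c^* *: dsum_star a.
Proof. by apply/ffunP => i; rewrite !ffunE starZ. Qed.
Fact dsum_starM (a b : D) : dsum_star (a * b) = dsum_star b * dsum_star a.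
Proof. by apply/ffunP => i; rewrite !ffunE starM. Qed.

HB.instance Definition _ := isStarAlgebra.Build R D
  dsum_starK dsum_starD dsum_starZ dsum_starM.

End DirectSum.

Section Universal.
Variables (R : realType) (gT : finGroupType) (G : {group gT}).

(* The universal unital C*-algebra generated by elements u g, g \in G, subject
   to the relations rel. The zero algebra is not a cstarAlgType, but as a
   target it satisfies the universal property trivially. *)
Definition universal_cstar (rel : forall B : cstarAlgType R, (gT -> B) -> Prop)
    (A : cstarAlgType R) (u : gT -> A) : Prop :=
  rel A u /\
  forall (B : cstarAlgType R) (v : gT -> B), rel B v ->
    exists phi : A -> B,
      [/\ star_hom phi, {in G, forall g, phi (u g) = v g} &
          forall psi : A -> B, star_hom psi ->
            {in G, forall g, psi (u g) = v g} -> psi =1 phi].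

Definition partial_rep (B : cstarAlgType R) (v : gT -> B) : Prop :=
  [/\ v 1%g = 1,
      {in G, forall g, v g^-1%g = star (v g)} &
      {in G &, forall g h, v g * v h * v h^-1%g = v (g * h)%g * v h^-1%g}].

Definition unitary_rep (B : cstarAlgType R) (v : gT -> B) : Prop :=
  [/\ v 1%g = 1,
      {in G &, forall g h, v (g * h)%g = v g * v h} &
      {in G, forall g, star (v g) * v g = 1 /\ v g * star (v g) = 1}].

Definition is_partial_group_cstar (A : cstarAlgType R) (u : gT -> A) : Prop :=
  universal_cstar partial_rep u.

Definition is_group_cstar (A : cstarAlgType R) (u : gT -> A) : Prop :=
  universal_cstar unitary_rep u.

End Universal.

Section Tuples.
Variables (gT : finGroupType) (G : {group gT}).
Implicit Types (n : nat) (tau : {set gT}).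

Definition ntuples n : {set {set gT}} :=
  [set tau : {set gT} | [&& tau \subset G, 1%g \in tau & #|tau| == n]].

Definition par_orbit_rel : rel {set gT} := fun tau tau' =>
  [exists g in G, (g^-1 \in tau)%g && (tau' == g *: tau)%g].

Definition orbits n : {set {set {set gT}}} :=
  equivalence_partition par_orbit_rel (ntuples n).

Definition orbit_type n : finType := {z : {set {set gT}} | z \in orbits n}.

Lemma ord_gt0 : (0 < #|'I_#|G| |)%N.
Proof. by rewrite card_ord cardG_gt0. Qed.

Lemma ntuples_nonempty (n : 'I_#|G|) : exists tau, tau \in ntuples n.+1.
Proof.
exists (1%g |: [set x in take n (enum (G :\ 1%g))]).
have sub x : x \in take n (enum (G :\ 1%g)) -> (x != 1%g) && (x \in G).
  by move/mem_take; rewrite mem_enum !inE.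
rewrite inE setU11 /=; apply/andP; split.
  by apply/subsetP=> x; rewrite !inE => /orP[/eqP->|/sub/andP[]].
rewrite cardsU1 inE; have -> /= : 1%g \notin take n (enum (G :\ 1%g)).
  by apply/negP => /sub; rewrite eqxx.
rewrite add1n eqSS cardsE (card_uniqP _) ?take_uniq ?enum_uniq //.
rewrite size_takel // -cardE.
by have := cardsD1 1%g G; rewrite group1 add1n -ltnS => <-.
Qed.

Lemma orbit_type_gt0 (n : 'I_#|G|) : (0 < #|orbit_type n.+1|)%N.
Proof.
have [tau tauT] := ntuples_nonempty n; rewrite card_sig; apply/card_gt0P.
by exists [set y in ntuples n.+1 | par_orbit_rel tau y]; rewrite inE imset_f.
Qed.

Definition lstab tau : {set gT} := [set h in G | (h *: tau)%g == tau].

Lemma group_set_lstab tau : group_set (lstab tau).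
Proof.
apply/group_setP; split=> [|g h]; rewrite !inE; first by rewrite group1 lcoset1 /=.
case/andP=> gG /eqP gt /andP[hG /eqP ht]; rewrite groupM //=.
by rewrite lcosetM ht gt.
Qed.

Canonical lstab_group tau : {group gT} := Group (group_set_lstab tau).

Definition mindex n tau : nat := (n %/ #|lstab tau|).-1.

(* x_0, ..., x_m enumerate representatives of the right cosets of the
   stabiliser contained in tau; then the orbit of tau is the set of the
   (x_i)^-1 *: tau. *)
Definition rcoset_reps n tau (x : 'I_(mindex n tau).+1 -> gT) : Prop :=
  injective (fun i => lstab tau :* x i)%g /\
  [set (lstab tau :* x i)%g | i : 'I_(mindex n tau).+1] = rcosets (lstab tau) tau.

End Tuples.

(* Main.v *)
Require Import Defs.
From HB Require Import structures.
From mathcomp Require Import all_boot all_order all_fingroup all_algebra complex.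
From mathcomp Require Import reals.
From mathcomp Require Import ring lra.

Import Order.TTheory GRing.Theory Num.Theory.
Local Open Scope ring_scope.

(** The subsets t of G that contain 1 are the objects of a finite groupoid: an
    arrow is a pair (g, t) with g^-1 \in t, leading from t to g *: t. The partial
    group C*-algebra of G is the convolution algebra of this groupoid, and a
    finite groupoid is, up to equivalence, the disjoint union of the isotropy
    groups of its components. A component with m + 1 objects and isotropy group H
    contributes (m + 1) x (m + 1) matrices over the group algebra of H. The
    components are the orbits z, the isotropy group of tau_z is its stabiliser
    H_z, and the objects of z are the translates (x_i)^-1 *: tau_z.

    The first identification rests on the range projections
    e_h = v h * v h^-1 of a partial representation v. They commute, so that the
    products [atom t] of the e_h (h \in t) and the 1 - e_h (h \notin t) form a
    partition of unity indexed by subsets, with v g * atom t = atom (g *: t) * v g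
    (atom_shift). Sending the arrow (g, t) to v g * atom t is then a
    homomorphism from the convolution algebra (par_lift_hom), and for the
    canonical partial representation in the convolution algebra it is the
    identity (par_lift_conv_gen). To compare with the universal C*-algebra in
    both directions, the convolution algebra has to be a C*-algebra: it acts on
    itself by left multiplication, the sum of the coefficients at the units gives
    an inner product for which this action is a *-representation, and the
    operator norm is a C*-norm. Finite dimension yields boundedness of the
    action and completeness. The group C*-algebra of H is treated in the same
    way, as the convolution algebra of the groupoid with the single object H;
    the outcome is that the unitaries w h form a basis (group_cstar_basis).

    For the second identification, the entry (i, j) at the orbit z of the image
    of a is the sum over h \in H_z of a ((x_i)^-1 * h * x_j, (x_j)^-1 *: tau_z)
    times w h. This is multiplicative because the arrows out of
    (x_l)^-1 *: tau_z are the (x_j)^-1 * h * x_l, each for exactly one j and one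
    h (sum_reps). It is bijective because the same parametrisation, over all
    orbits, enumerates every arrow exactly once (component_index_surj,
    component_index_inj). *)

Set Implicit Arguments.
Unset Strict Implicit.
Unset Printing Implicit Defensive.

Local Open Scope complex_scope.

(** * Elementary facts on *-algebras *)

Section StarTheory.
Variables (R : realType) (B : starAlgType R).

Lemma star0 : star (0 : B) = 0.
Proof. by apply: (addrI (star 0)); rewrite -starD !addr0. Qed.

(** The axiom starZ conjugates through the numClosedFieldType structure of R[i];
    the lemmas on complex numbers speak of conjc, which is convertible to it. *)
Lemma starZ_conjc (k : R[i]) (x : B) : star (k *: x) = conjc k *: star x.
Proof. exact: starZ. Qed.

Lemma star_sum I (r : seq I) (P : pred I) (F : I -> B) :
  star (\sum_(i <- r | P i) F i) = \sum_(i <- r | P i) star (F i).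
Proof. exact: (big_morph _ (@starD _ B) star0). Qed.

End StarTheory.

(** * C*-norms from faithful positive functionals *)

(** A real functional making star x * y a Hilbert space inner product for which
    left multiplications are bounded: the real part of a faithful positive
    functional, whose inner product has the same lengths as the complex one. *)
Record gns_functional (R : realType) (B : starAlgType R) (t : B -> R) : Prop :=
  GnsFunctional {
    gns_add : {morph t : x y / x + y};
    gns_scale : forall (c : R) x, t (c%:C *: x) = c * t x;
    gns_star : forall x, t (star x) = t x;
    gns_ge0 : forall x, 0 <= t (star x * x);
    gns_faithful : forall x, t (star x * x) = 0 -> x = 0;
    gns_bounded : forall x, exists K, forall y,
      t (star (x * y) * (x * y)) <= K * t (star y * y)
  }.

Section OperatorNorm.
Variables (R : realType) (B : starAlgType R) (t : B -> R).
Hypothesis ht : gns_functional t.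

Let tD := gns_add ht.
Let tZ := gns_scale ht.
Let t_star := gns_star ht.
Let t_ge0 := gns_ge0 ht.
Let t_faithful := gns_faithful ht.
Let t_bound := gns_bounded ht.

Local Notation ip x y := (t (star x * y)).

Definition gns_norm (x : B) : R := Num.sqrt (ip x x).
Local Notation n2 := gns_norm.

Let ipC x y : ip x y = ip y x.
Proof. by rewrite -t_star starM starK. Qed.

Let t0 : t 0 = 0.
Proof. by apply: (addrI (t 0)); rewrite -tD !addr0. Qed.

Let n2_0 : n2 0 = 0. Proof. by rewrite /n2 mulr0 t0 sqrtr0. Qed.

Let n2_ge0 x : 0 <= n2 x. Proof. exact: sqrtr_ge0. Qed.

Lemma gns_norm_sqr x : n2 x ^+ 2 = ip x x. Proof. by rewrite sqr_sqrtr. Qed.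

Let n2Z (k : R[i]) x : n2 (k *: x) = complex.Re `|k| * n2 x.
Proof.
have nk : complex.Re `|k| ^+ 2 = complex.Re (conjc k * k).
  rewrite [conjc k * k]mulrC -sqr_normc -[in RHS](RRe_real (normr_real k)).
  by rewrite -rmorphXn.
have kr : (complex.Re `|k| ^+ 2)%:C = conjc k * k.
  by rewrite nk RRe_real // mulrC -sqr_normc rpredX ?normr_real.
rewrite /n2 starZ_conjc -scalerAl -scalerAr scalerA -kr tZ sqrtrM ?sqr_ge0 //.
by rewrite sqrtr_sqr ger0_norm // normc_def /= sqrtr_ge0.
Qed.

(** The square of n2 y *: x - n2 x *: y is nonnegative. *)
Let cauchy_schwarz x y : ip x y <= n2 x * n2 y.
Proof.
have [y0|y0] := eqVneq (n2 y) 0.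
  have -> : y = 0 by apply: t_faithful; rewrite -gns_norm_sqr y0 expr0n.
  by rewrite mulr0 t0 mulr_ge0.
have [x0|x0] := eqVneq (n2 x) 0.
  have -> : x = 0 by apply: t_faithful; rewrite -gns_norm_sqr x0 expr0n.
  by rewrite star0 mul0r t0 mulr_ge0.
have px : 0 < n2 x by rewrite lt_def x0 n2_ge0.
have py : 0 < n2 y by rewrite lt_def y0 n2_ge0.
have := t_ge0 ((n2 y)%:C *: x + (- n2 x)%:C *: y).
rewrite starD !starZ_conjc !conjc_real mulrDl !mulrDr -!scalerAl -!scalerAr.
rewrite !tD !tZ (ipC y x) -!gns_norm_sqr => h.
have : 0 <= (n2 x * n2 y) * (n2 x * n2 y - ip x y) by nra.
by rewrite pmulr_rge0 ?mulr_gt0 // subr_ge0.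
Qed.

Let n2D x y : n2 (x + y) <= n2 x + n2 y.
Proof.
rewrite -ler_sqr ?nnegrE ?addr_ge0 // gns_norm_sqr starD mulrDl !mulrDr !tD (ipC y x).
by rewrite -!gns_norm_sqr; have := cauchy_schwarz x y; nra.
Qed.

Definition op_norm (x : B) : R :=
  sup (fun r : R => exists2 y, n2 y <= 1 & n2 (x * y) = r).

Let op_norm_has_sup x :
  classical_sets.has_sup (fun r : R => exists2 y, n2 y <= 1 & n2 (x * y) = r).
Proof.
split; first by exists (n2 (x * 0)), 0; rewrite //= n2_0.
have [K hK] := t_bound x; exists (Num.sqrt `|K|) => _ [y /= hy <-].
rewrite /n2 ler_sqrt // ?(le_trans (hK y)) //.
apply: (le_trans (ler_norm _)); rewrite normrM ler_piMr //.
by rewrite ger0_norm // -gns_norm_sqr expr_le1.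
Qed.

Let n2_le_op x y : n2 (x * y) <= op_norm x * n2 y.
Proof.
have [y0|y0] := eqVneq (n2 y) 0.
  have -> : y = 0 by apply: t_faithful; rewrite -gns_norm_sqr y0 expr0n.
  by rewrite mulr0 n2_0 mulr0.
have py : 0 < n2 y by rewrite lt_def y0 n2_ge0.
rewrite -ler_pdivrMr // mulrC.
have nV : complex.Re `| (n2 y)^-1%:C | = (n2 y)^-1.
  by rewrite normc_def /= expr0n /= addr0 sqrtr_sqr ger0_norm // invr_ge0.
rewrite -{1}nV -n2Z scalerAr.
apply: (ub_le_sup (proj2 (op_norm_has_sup x))).
by exists ((n2 y)^-1%:C *: y); rewrite //= n2Z nV mulVf.
Qed.

Lemma op_norm_le x K : 0 <= K -> (forall y, n2 (x * y) <= K * n2 y) -> op_norm x <= K.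
Proof.
move=> K0 hK; apply: ge_sup; first exact: (proj1 (op_norm_has_sup x)).
by move=> _ [y /= hy <-]; apply: le_trans (hK y) _; rewrite ler_piMr.
Qed.

Lemma op_norm_ge0 x : 0 <= op_norm x.
Proof.
apply: (le_trans (n2_ge0 (x * 0))); apply: (ub_le_sup (proj2 (op_norm_has_sup x))).
by exists 0; rewrite //= n2_0.
Qed.

Lemma gns_norm_le_op_norm x : n2 x <= op_norm x * n2 1.
Proof. by rewrite -{1}[x]mulr1. Qed.

Lemma op_norm_eq0 x : op_norm x = 0 -> x = 0.
Proof.
move=> x0; have := gns_norm_le_op_norm x; rewrite x0 mul0r => h.
by apply: t_faithful; rewrite -gns_norm_sqr; apply/eqP; rewrite sqrf_eq0 eq_le h n2_ge0.
Qed.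

Lemma op_normD x y : op_norm (x + y) <= op_norm x + op_norm y.
Proof.
apply: op_norm_le => [|z]; first by rewrite addr_ge0 ?op_norm_ge0.
by rewrite !mulrDl (le_trans (n2D _ _)) // lerD.
Qed.

Lemma op_normM x y : op_norm (x * y) <= op_norm x * op_norm y.
Proof.
apply: op_norm_le => [|z]; first by rewrite mulr_ge0 ?op_norm_ge0.
rewrite -mulrA (le_trans (n2_le_op _ _)) // -mulrA ler_wpM2l ?op_norm_ge0 //.
Qed.

Lemma op_normZ (k : R[i]) x : (op_norm (k *: x))%:C = `|k| * (op_norm x)%:C.
Proof.
have Re_ge0 (c : R[i]) : 0 <= complex.Re `|c|.
  by rewrite normc_def sqrtr_ge0.
have le c z : op_norm (c *: z) <= complex.Re `|c| * op_norm z.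
  apply: op_norm_le => [|y]; first by rewrite mulr_ge0 ?op_norm_ge0.
  by rewrite -scalerAl n2Z -mulrA ler_wpM2l.
have -> : `|k| = (complex.Re `|k|)%:C by rewrite RRe_real ?normr_real.
rewrite -rmorphM; congr (_ %:C); apply/eqP; rewrite eq_le.
apply/andP; split; first exact: le.
have [->|k0] := eqVneq k 0; first by rewrite normr0 mul0r op_norm_ge0.
have k0' : 0 < complex.Re `|k|.
  by rewrite -ltcR RRe_real ?normr_real // normr_gt0.
rewrite -ler_pdivlMl //; have := le k^-1 (k *: x).
rewrite scalerA mulVf // scale1r normfV -[`|k|]RRe_real ?normr_real //.
by rewrite -fmorphV.
Qed.

(** Left multiplication by star x is adjoint to left multiplication by x, so the
    squared length of x * y is the inner product of y with star x * x * y, and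
    Cauchy-Schwarz gives the nontrivial inequality. *)
Lemma op_norm_star_mul x : op_norm (star x * x) = op_norm x ^+ 2.
Proof.
have ge z : op_norm z ^+ 2 <= op_norm (star z * z).
  rewrite -[leRHS]sqr_sqrtr ?op_norm_ge0 // ler_sqr ?nnegrE ?sqrtr_ge0 ?op_norm_ge0 //.
  apply: op_norm_le => [|y]; first exact: sqrtr_ge0.
  rewrite -ler_sqr ?nnegrE ?mulr_ge0 ?sqrtr_ge0 // exprMn.
  rewrite (sqr_sqrtr (op_norm_ge0 _)) gns_norm_sqr starM -mulrA (mulrA (star z)).
  rewrite (le_trans (cauchy_schwarz _ _)) // expr2 mulrA [leRHS]mulrC.
  by rewrite ler_wpM2l.
have le_star z : op_norm z <= op_norm (star z).
  have [->|z0] := eqVneq (op_norm z) 0; first exact: op_norm_ge0.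
  have pz : 0 < op_norm z by rewrite lt_def z0 op_norm_ge0.
  rewrite -(ler_pM2r pz) -expr2 (le_trans (ge z)) //; exact: op_normM.
apply/eqP; rewrite eq_le ge andbT (le_trans (op_normM _ _)) // expr2.
by rewrite ler_wpM2r ?op_norm_ge0 // -{2}[x]starK le_star.
Qed.

End OperatorNorm.

(** * The groupoid of partial translations *)

Section PartialTranslation.
Variables (gT : finGroupType) (T : {set {set gT}}).

Definition par_invariant : Prop :=
  [/\ T != set0, {in T, forall t : {set gT}, 1%g \in t} &
      {in T, forall (t : {set gT}) g, (g^-1)%g \in t -> (g *: t)%g \in T}].

(** (g, t) is the arrow from t to g *: t. *)
Definition arrow : pred (gT * {set gT}) :=
  fun p => (p.2 \in T) && (p.1^-1 \in p.2)%g.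

Hypothesis hT : par_invariant.

Lemma arrow1 t : arrow (1%g, t) = (t \in T).
Proof.
case: hT => _ T1 _; rewrite /arrow /= invg1.
by case tT: (t \in T) => //=; rewrite T1.
Qed.

Lemma arrow_comp g h t :
  arrow (h, t) -> arrow (g, (h *: t)%g) -> arrow ((g * h)%g, t).
Proof.
case/andP=> /= tT ht /andP[_ /=].
by rewrite mem_lcoset /arrow /= tT invMg.
Qed.

Lemma arrow_target g t : arrow (g, t) -> (g *: t)%g \in T.
Proof. by case: hT => _ _ h3 /andP[/h3 h4 /h4]. Qed.

Lemma arrow_inv g t : arrow (g^-1, g *: t)%g = arrow (g, t).
Proof.
case: hT => _ T1 Tg.
have inv h s : arrow (h, s) -> arrow (h^-1, h *: s)%g.
  move=> hs; rewrite /arrow /= invgK arrow_target //= mem_lcoset mulVg.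
  by case/andP: hs => /T1.
apply/idP/idP => [/inv|/inv//].
by rewrite invgK -lcosetM mulVg lcoset1.
Qed.

End PartialTranslation.

(** * The convolution algebra *)

(** Elements are functions on all pairs that vanish outside the arrows, so that
    sums over the group need no side condition. *)
Definition supported (R : realType) (gT : finGroupType) (T : {set {set gT}}) :
    {pred {ffun gT * {set gT} -> R[i]}} :=
  fun a => [forall p, (a p != 0) ==> arrow T p].

Fact supported_submod (R : realType) (gT : finGroupType) (T : {set {set gT}}) :
  submod_closed (@supported R gT T).
Proof.
split=> [|k a b /forallP ha /forallP hb]; apply/forallP => p; rewrite !ffunE.
  by rewrite eqxx.
apply/implyP; have := ha p; have := hb p; rewrite !implybE.
case: (arrow T p); rewrite ?orbT // !orbF !negbK => /eqP-> /eqP->.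
by rewrite scaler0 addr0 eqxx.
Qed.

HB.instance Definition _ (R : realType) (gT : finGroupType) T :=
  GRing.isSubmodClosed.Build R[i] {ffun gT * {set gT} -> R[i]}
    (@supported R gT T) (@supported_submod R gT T).

Record conv (R : realType) (gT : finGroupType) (T : {set {set gT}})
    (hT : par_invariant T) :=
  Conv { conv_val :> {ffun gT * {set gT} -> R[i]}; _ : conv_val \in @supported R gT T }.

Section Convolution.
Variables (R : realType) (gT : finGroupType) (T : {set {set gT}}).
Variable hT : par_invariant T.

Local Notation L := (conv R hT).

HB.instance Definition _ := [isSub for @conv_val R gT T hT].
HB.instance Definition _ := [Choice of L by <:].
HB.instance Definition _ := [SubChoice_isSubLmodule of L by <:].

Lemma conv_out (a : L) p : ~~ arrow T p -> a p = 0.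
Proof.
case: a => a /= /forallP/(_ p); rewrite implybE negbK.
by case/orP => [/eqP//|->].
Qed.

Lemma conv_ext (a b : L) : (forall g t, a (g, t) = b (g, t)) -> a = b.
Proof. by move=> ab; apply: val_inj; apply/ffunP => -[g t]; exact: ab. Qed.

Fact mk_conv_supported (F : gT -> {set gT} -> R[i]) :
  [ffun p => if arrow T p then F p.1 p.2 else 0] \in @supported R gT T.
Proof.
by apply/forallP => p; rewrite ffunE; case: ifP; rewrite ?eqxx ?implybT.
Qed.
Definition mk_conv F : L := Conv hT (mk_conv_supported F).

Lemma mk_convE F g t :
  mk_conv F (g, t) = if arrow T (g, t) then F g t else 0.
Proof. by rewrite ffunE. Qed.

(** The arrow (g, t) factors as (g * k^-1, k *: t) after (k, t). *)
Definition conv_mul (a b : L) : L :=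
  mk_conv (fun g t => \sum_k a ((g * k^-1)%g, (k *: t)%g) * b (k, t)).
Definition conv_one : L := mk_conv (fun g _ => (g == 1%g)%:R).
Definition conv_star (a : L) : L :=
  mk_conv (fun g t => conjc (a ((g^-1)%g, (g *: t)%g))).

(** The truncation built into [mk_conv] is harmless: a nonzero summand exhibits
    (g, t) as a composite of arrows. *)
Lemma conv_mulE a b g t :
  conv_mul a b (g, t) = \sum_k a ((g * k^-1)%g, (k *: t)%g) * b (k, t).
Proof.
rewrite mk_convE; case: ifPn => // gt; rewrite big1 // => k _.
have [kt|nb] := boolP (arrow T (k, t)); last by rewrite (conv_out b nb) mulr0.
have [/(arrow_comp kt)|na] := boolP (arrow T ((g * k^-1)%g, (k *: t)%g)).
  by rewrite mulgKV (negPf gt).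
by rewrite (conv_out a na) mul0r.
Qed.

Lemma conv_oneE g t : conv_one (g, t) = ((g == 1%g) && (t \in T))%:R.
Proof.
rewrite mk_convE; have [->|g1] := eqVneq g 1%g; last by case: ifP.
by rewrite (arrow1 hT); case: (t \in T).
Qed.

Lemma conv_starE a g t : conv_star a (g, t) = conjc (a ((g^-1)%g, (g *: t)%g)).
Proof.
rewrite mk_convE; case: ifPn => // gt; rewrite conv_out ?conjc0 //.
by rewrite (arrow_inv hT).
Qed.

Lemma convDE (a b : L) p : (a + b) p = a p + b p.
Proof. by rewrite ffunE. Qed.

Lemma convZE k (a : L) p : (k *: a) p = k * a p.
Proof. by rewrite ffunE. Qed.

Fact conv_mulA : associative conv_mul.
Proof.
move=> a b c; apply: conv_ext => g t; rewrite !conv_mulE.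
under eq_bigr do rewrite conv_mulE mulr_sumr.
under [RHS]eq_bigr do rewrite conv_mulE mulr_suml.
rewrite exchange_big; apply: eq_bigr => k _ /=.
rewrite [RHS](reindex_inj (mulIg (k^-1)%g)); apply: eq_bigr => m _ /=.
by rewrite mulrA invMg invgK -lcosetM -!mulgA mulVg mulg1 mulKg.
Qed.

Fact conv_mul1l : left_id conv_one conv_mul.
Proof.
move=> a; apply: conv_ext => g t; rewrite conv_mulE (bigD1 g) //= big1 => [|k kg].
  rewrite conv_oneE mulgV eqxx addr0.
  have [gt|nt] := boolP (arrow T (g, t)); last by rewrite (conv_out _ nt) mulr0.
  by rewrite (arrow_target hT gt) mul1r.
by rewrite conv_oneE -eq_mulgV1 eq_sym (negPf kg) mul0r.
Qed.

Fact conv_mul1r : right_id conv_one conv_mul.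
Proof.
move=> a; apply: conv_ext => g t.
rewrite conv_mulE (bigD1 1%g) //= big1 => [|k kg].
  rewrite conv_oneE eqxx invg1 mulg1 lcoset1 addr0 /=.
  have [_|nt] := boolP (t \in T); first by rewrite mulr1.
  by rewrite conv_out ?mul0r //; apply: contra nt => /andP[].
by rewrite conv_oneE (negPf kg) mulr0.
Qed.

Fact conv_mulDl : left_distributive conv_mul +%R.
Proof.
move=> a b c; apply: conv_ext => g t; rewrite convDE !conv_mulE -big_split.
by apply: eq_bigr => k _; rewrite convDE mulrDl.
Qed.

Fact conv_mulDr : right_distributive conv_mul +%R.
Proof.
move=> a b c; apply: conv_ext => g t; rewrite convDE !conv_mulE -big_split.
by apply: eq_bigr => k _; rewrite convDE mulrDr.
Qed.

Fact conv_one_neq0 : conv_one != 0.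
Proof.
case: (hT) => /set0Pn[t tT] _ _; apply/eqP => e; have := conv_oneE 1%g t.
by rewrite e ffunE tT eqxx => /eqP; rewrite eq_sym oner_eq0.
Qed.

HB.instance Definition _ := GRing.Zmodule_isNzRing.Build L
  conv_mulA conv_mul1l conv_mul1r conv_mulDl conv_mulDr conv_one_neq0.

Fact conv_scaleAl (k : R[i]) (a b : L) : k *: (a * b) = (k *: a) * b.
Proof.
apply: conv_ext => g t; rewrite convZE !conv_mulE mulr_sumr.
by apply: eq_bigr => h _; rewrite convZE mulrA.
Qed.

HB.instance Definition _ := GRing.Lmodule_isLalgebra.Build R[i] L conv_scaleAl.

Fact conv_scaleAr (k : R[i]) (a b : L) : k *: (a * b) = a * (k *: b).
Proof.
apply: conv_ext => g t; rewrite convZE !conv_mulE mulr_sumr.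
by apply: eq_bigr => h _; rewrite convZE mulrCA.
Qed.

HB.instance Definition _ := GRing.Lalgebra_isAlgebra.Build R[i] L conv_scaleAr.

Fact conv_starK : involutive conv_star.
Proof.
move=> a; apply: conv_ext => g t.
by rewrite !conv_starE conjcK invgK -lcosetM mulVg lcoset1.
Qed.

Fact conv_starD : {morph conv_star : a b / a + b}.
Proof.
by move=> a b; apply: conv_ext => g t; rewrite !(conv_starE, convDE) rmorphD.
Qed.

Fact conv_starZ (k : R[i]) (a : L) :
  conv_star (k *: a) = conjc k *: conv_star a.
Proof. by apply: conv_ext => g t; rewrite !(conv_starE, convZE) rmorphM. Qed.

Fact conv_starM (a b : L) : conv_star (a * b) = conv_star b * conv_star a.
Proof.
apply: conv_ext => g t; rewrite conv_starE !conv_mulE rmorph_sum.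
rewrite [RHS](reindex_inj (mulIg g)); apply: eq_bigr => k _.
rewrite rmorphM !conv_starE mulrC -!lcosetM !invMg !invgK.
by rewrite mulgK mulKVg mulKg.
Qed.

HB.instance Definition _ := isStarAlgebra.Build R L
  conv_starK conv_starD conv_starZ conv_starM.

(** The real part of the sum of the coefficients at the units (1, t). *)
Definition conv_trace (a : L) : R := \sum_t complex.Re (a (1%g, t)).

End Convolution.

(** * Completeness of the complex numbers *)

Section Completeness.
Variable R : realType.

Lemma real_cauchy_complete (a : nat -> R) :
  (forall e : R, 0 < e -> exists N : nat, forall m n : nat,
     (N <= m)%N -> (N <= n)%N -> `|a m - a n| < e) ->
  exists l, forall e : R, 0 < e -> exists N : nat, forall n : nat,
     (N <= n)%N -> `|a n - l| < e.
Proof.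
move=> ca; pose E (y : R) := exists N : nat, forall n, (N <= n)%N -> y <= a n.
(* E is the set of eventual lower bounds of the sequence; its supremum is the
   inferior limit, hence the limit. *)
have supE : classical_sets.has_sup E.
  have [N hN] := ca 1 ltr01.
  split.
    exists (a N - 1), N => n Nn; have := hN _ _ (leqnn N) Nn.
    by rewrite ltr_norml => /andP[_]; lra.
  exists (a N + 1) => y [M hM].
  have := hN _ _ (leq_maxl N M) (leqnn N); have := hM _ (leq_maxr N M).
  by rewrite ltr_norml => + /andP[_]; lra.
exists (sup E) => e e0; have [N hN] := ca (e / 2) ltac:(lra).
exists N => n Nn.
have lo : a n - e / 2 <= sup E.
  apply: (ub_le_sup (proj2 supE)); exists N => m Nm.
  by have := hN _ _ Nn Nm; rewrite ltr_norml => /andP[_]; lra.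
have hi : sup E <= a n + e / 2.
  apply: ge_sup; first exact: (proj1 supE).
  move=> y [M hM].
  have := hN _ _ (leq_trans Nn (leq_maxl n M)) Nn.
  by have := hM _ (leq_maxr n M); rewrite ltr_norml => + /andP[_]; lra.
by rewrite ltr_norml; lra.
Qed.

Local Notation nc := (@Normc.normc R).

Lemma normc_ge0 z : 0 <= nc z.
Proof. by case: z => x y; rewrite sqrtr_ge0. Qed.

Lemma le_normc_sum I (r : seq I) (P : pred I) (F : I -> R[i]) :
  nc (\sum_(i <- r | P i) F i) <= \sum_(i <- r | P i) nc (F i).
Proof.
elim/big_rec2: _ => [|i y x _ le]; first by rewrite Normc.normc0.
by rewrite (le_trans (le_normcD _ _)) // lerD2l.
Qed.

Lemma sqr_normcE z : nc z ^+ 2 = complex.Re (conjc z * z).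
Proof.
case: z => x y /=; rewrite sqr_sqrtr ?addr_ge0 ?sqr_ge0 //; ring.
Qed.

Lemma Re_le_normc z : `|complex.Re z| <= nc z.
Proof.
by case: z => x y /=; rewrite -sqrtr_sqr ler_sqrt ?lerDl ?sqr_ge0 // addr_ge0 ?sqr_ge0.
Qed.

Lemma Im_le_normc z : `|complex.Im z| <= nc z.
Proof.
by case: z => x y /=; rewrite -sqrtr_sqr ler_sqrt ?lerDr ?sqr_ge0 // addr_ge0 ?sqr_ge0.
Qed.

Lemma normc_le_ReIm z : nc z <= `|complex.Re z| + `|complex.Im z|.
Proof.
case: z => x y /=; rewrite -ler_sqr ?nnegrE ?addr_ge0 ?sqrtr_ge0 //.
rewrite sqr_sqrtr ?addr_ge0 ?sqr_ge0 // sqrrD !real_normK ?num_real //.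
rewrite [leRHS]addrAC lerDl mulrn_wge0 ?mulr_ge0 //.
Qed.

Lemma complex_cauchy_complete (a : nat -> R[i]) :
  (forall e : R, 0 < e -> exists N : nat, forall m n : nat,
     (N <= m)%N -> (N <= n)%N -> nc (a m - a n) < e) ->
  exists l, forall e : R, 0 < e -> exists N : nat, forall n : nat,
     (N <= n)%N -> nc (a n - l) < e.
Proof.
move=> ca.
have [|x hx] := @real_cauchy_complete (fun n => complex.Re (a n)).
  move=> e /ca[N hN]; exists N => m n Nm Nn.
  by rewrite (le_lt_trans _ (hN _ _ Nm Nn)) // (le_trans _ (Re_le_normc _)) // raddfB.
have [|y hy] := @real_cauchy_complete (fun n => complex.Im (a n)).
  move=> e /ca[N hN]; exists N => m n Nm Nn.
  by rewrite (le_lt_trans _ (hN _ _ Nm Nn)) // (le_trans _ (Im_le_normc _)) // raddfB.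
exists (x +i* y) => e e0.
have [N hN] := hx (e / 2) ltac:(lra); have [M hM] := hy (e / 2) ltac:(lra).
exists (maxn N M) => n; rewrite geq_max => /andP[/hN h1 /hM h2].
rewrite (le_lt_trans (normc_le_ReIm _)) // !raddfB /=; lra.
Qed.

End Completeness.

(** * The convolution algebra is a C*-algebra *)

Section ConvolutionNorm.
Variables (R : realType) (gT : finGroupType) (T : {set {set gT}}).
Variable hT : par_invariant T.

Local Notation L := (conv R hT).
Local Notation nc := (@Normc.normc R).
Local Notation tr := (@conv_trace R gT T hT).
Implicit Types a b : L.

Fact conv_traceD : {morph tr : a b / a + b}.
Proof.
move=> a b; rewrite /conv_trace -big_split; apply: eq_bigr => t _.
by rewrite convDE raddfD.
Qed.

Fact conv_traceZ (c : R) a : tr (c%:C *: a) = c * tr a.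
Proof.
rewrite /conv_trace mulr_sumr; apply: eq_bigr => t _.
by rewrite convZE; case: (a _) => x y /=; rewrite mul0r subr0.
Qed.

Fact conv_trace_star a : tr (star a) = tr a.
Proof.
apply: eq_bigr => t _; rewrite conv_starE lcoset1 invg1.
by case: (a _).
Qed.

(** The associated inner product is the standard one on coefficients. *)
Lemma conv_trace_star_mul a b :
  tr (star a * b) = \sum_p complex.Re (conjc (a p) * b p).
Proof.
transitivity (\sum_t \sum_g complex.Re (conjc (a (g, t)) * b (g, t))).
  apply: eq_bigr => t _; rewrite conv_mulE raddf_sum; apply: eq_bigr => k _ /=.
  by rewrite conv_starE mul1g invgK -lcosetM mulVg lcoset1.
rewrite exchange_big pair_bigA; by apply: eq_bigr => -[].
Qed.

Lemma conv_trace_sqr a : tr (star a * a) = \sum_p nc (a p) ^+ 2.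
Proof.
by rewrite conv_trace_star_mul; apply: eq_bigr => p _; rewrite sqr_normcE.
Qed.

Fact conv_trace_ge0 a : 0 <= tr (star a * a).
Proof. by rewrite conv_trace_sqr sumr_ge0 // => p _; rewrite sqr_ge0. Qed.

Lemma normc_le_trace a p : nc (a p) ^+ 2 <= tr (star a * a).
Proof.
rewrite conv_trace_sqr (bigD1 p) //= lerDl sumr_ge0 // => q _.
exact: sqr_ge0.
Qed.

Fact conv_trace_faithful a : tr (star a * a) = 0 -> a = 0.
Proof.
move=> a0; apply: conv_ext => g t; rewrite ffunE; apply: Normc.eq0_normc.
apply/eqP; rewrite -sqrf_eq0 eq_le sqr_ge0 andbT -a0; exact: normc_le_trace.
Qed.

(** The l1 norm is comparable with the operator norm: this bounds left
    multiplications, and reduces completeness to that of each coefficient. *)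
Definition conv_sum_norm (a : L) : R := \sum_p nc (a p).
Definition conv_bound : R := #|{: gT * {set gT}}|%:R * #|gT|%:R.

(** Every coefficient of a * b is a sum of #|gT| products, each at most the l1
    norm of a times the l2 norm of b. *)
Lemma conv_trace_bound a b :
  tr (star (a * b) * (a * b)) <=
  (conv_bound * conv_sum_norm a) ^+ 2 * tr (star b * b).
Proof.
have sn p : nc (a p) <= conv_sum_norm a.
  by rewrite /conv_sum_norm (bigD1 p) //= lerDl sumr_ge0 // => q _; exact: normc_ge0.
have sn0 : 0 <= conv_sum_norm a by rewrite sumr_ge0 // => q _; exact: normc_ge0.
set s := conv_sum_norm a in sn sn0 *; set q := tr (star b * b).
have ab p : nc ((a * b) p) <= #|gT|%:R * (s * Num.sqrt q).
  case: p => g t; rewrite conv_mulE (le_trans (le_normc_sum _ _ _)) //.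
  rewrite mulr_natl -sumr_const; apply: ler_sum => k _.
  rewrite Normc.normcM ler_pM ?normc_ge0 //.
  rewrite -ler_sqr ?nnegrE ?normc_ge0 ?sqrtr_ge0 // sqr_sqrtr ?conv_trace_ge0 //.
  exact: normc_le_trace.
rewrite conv_trace_sqr.
apply: (@le_trans _ _ (\sum_(p : gT * {set gT}) (#|gT|%:R * (s * Num.sqrt q)) ^+ 2)).
  apply: ler_sum => p _; rewrite ler_sqr ?nnegrE ?normc_ge0 //.
  by rewrite !mulr_ge0 ?sqrtr_ge0 ?ler0n.
rewrite sumr_const -[_ *+ _]mulr_natl.
have -> : (#|gT|%:R * (s * Num.sqrt q)) ^+ 2 = #|gT|%:R ^+ 2 * (s ^+ 2 * q).
  by rewrite !exprMn sqr_sqrtr // conv_trace_ge0.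
rewrite /conv_bound !exprMn -!mulrA [leRHS]mulrA ler_wpM2r //.
  by rewrite !mulr_ge0 ?sqr_ge0 ?conv_trace_ge0.
rewrite -natrM ler_nat leq_pmulr //.
by apply/card_gt0P; exists (1%g, set0).
Qed.

Fact conv_gns_functional : gns_functional tr.
Proof.
split; [exact: conv_traceD | exact: conv_traceZ | exact: conv_trace_star
  | exact: conv_trace_ge0 | exact: conv_trace_faithful |].
by move=> a; eexists => b; exact: conv_trace_bound.
Qed.

Definition conv_norm : L -> R := op_norm tr.

Lemma conv_norm_le a : conv_norm a <= conv_bound * conv_sum_norm a.
Proof.
have c0 : 0 <= conv_bound * conv_sum_norm a.
  rewrite !mulr_ge0 ?ler0n // sumr_ge0 // => p _; exact: normc_ge0.
apply: (op_norm_le conv_gns_functional c0) => b.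
rewrite -ler_sqr ?nnegrE ?sqrtr_ge0 ?(mulr_ge0 c0 (sqrtr_ge0 _)) //.
rewrite exprMn !(gns_norm_sqr conv_gns_functional).
exact: conv_trace_bound.
Qed.

Lemma normc_le_conv_norm a p : nc (a p) <= conv_norm a * gns_norm tr 1.
Proof.
apply: le_trans (gns_norm_le_op_norm conv_gns_functional a).
rewrite -ler_sqr ?nnegrE ?normc_ge0 ?sqrtr_ge0 //.
rewrite (gns_norm_sqr conv_gns_functional).
exact: normc_le_trace.
Qed.

Fact conv_norm_complete (a : nat -> L) :
    (forall e : R, 0 < e -> exists N : nat, forall m n : nat,
       (N <= m)%N -> (N <= n)%N -> conv_norm (a m - a n) < e) ->
    exists l : L, forall e : R, 0 < e -> exists N : nat, forall n : nat,
       (N <= n)%N -> conv_norm (a n - l) < e.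
Proof.
move=> ca; set d := gns_norm tr 1.
have d0 : 0 <= d by exact: sqrtr_ge0.
have subE (b c : L) p : (b - c) p = b p - c p by rewrite !ffunE.
have /fin_all_exists[l hl] (p : gT * {set gT}) : exists l,
    forall e : R, 0 < e -> exists N : nat, forall n : nat,
      (N <= n)%N -> nc (a n p - l) < e.
  apply: complex_cauchy_complete => e e0.
  have d1 : 0 < d + 1 by lra.
  have [N hN] := ca _ (divr_gt0 e0 d1); exists N => m n Nm Nn.
  rewrite -subE (le_lt_trans (normc_le_conv_norm _ p)) -/d //.
  have := hN _ _ Nm Nn; rewrite ltr_pdivlMr // => h.
  rewrite (le_lt_trans _ h) // ler_wpM2l ?lerDl //.
  exact: (op_norm_ge0 conv_gns_functional).
exists (mk_conv hT (fun g t => l (g, t))) => e e0.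
(* The summand 1 only serves to make c positive. *)
pose c : R := conv_bound * #|{: gT * {set gT}}|%:R + 1.
have c0 : 0 < c by rewrite ltr_wpDl // !mulr_ge0 ?ler0n.
have /fin_all_exists[N hN] p := hl p _ (divr_gt0 e0 c0).
exists (\max_p N p) => n Nn.
rewrite (le_lt_trans (conv_norm_le _)) //.
apply: (@le_lt_trans _ _ (conv_bound * (#|{: gT * {set gT}}|%:R * (e / c)))).
  rewrite ler_wpM2l ?mulr_ge0 ?ler0n // mulr_natl -sumr_const.
  apply: ler_sum => -[g t] _; rewrite subE mk_convE; case: ifPn => [_|nt].
    by apply/ltW/hN/(leq_trans _ Nn)/leq_bigmax.
  by rewrite conv_out // subr0 Normc.normc0 ltW // divr_gt0.
rewrite mulrA mulrA ltr_pdivrMr // mulrC ltr_pM2l // ltrDl //.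
Qed.

HB.instance Definition _ := StarAlgebra_isCStar.Build R L
  (op_norm_eq0 conv_gns_functional) (op_normD conv_gns_functional)
  (op_normZ conv_gns_functional) (op_normM conv_gns_functional)
  (op_norm_star_mul conv_gns_functional) conv_norm_complete.

End ConvolutionNorm.

(** * Homomorphisms of *-algebras *)

Section StarHom.
Variables (R : realType) (A B C : starAlgType R) (f : A -> B) (f' : B -> C).
Hypotheses (hf : star_hom f) (hf' : star_hom f').

Lemma star_homD : {morph f : x y / x + y}.
Proof. by case: hf => lf _ _ x y; have := lf 1 x y; rewrite !scale1r. Qed.

Lemma star_hom0 : f 0 = 0.
Proof. by apply: (addrI (f 0)); rewrite -star_homD !addr0. Qed.

Lemma star_homZ k x : f (k *: x) = k *: f x.
Proof.
by case: hf => lf _ _; rewrite -[k *: x]addr0 lf star_hom0 addr0.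
Qed.

Lemma star_homB : {morph f : x y / x - y}.
Proof. by move=> x y; rewrite star_homD -scaleN1r star_homZ scaleN1r. Qed.

Lemma star_hom1 : f 1 = 1.
Proof. by case: hf => _ []. Qed.

Lemma star_homM : {morph f : x y / x * y}.
Proof. by case: hf => _ []. Qed.

Lemma star_hom_sum I (r : seq I) (P : pred I) (F : I -> A) :
  f (\sum_(i <- r | P i) F i) = \sum_(i <- r | P i) f (F i).
Proof. exact: (big_morph _ star_homD star_hom0). Qed.

Lemma star_hom_prod I (r : seq I) (P : pred I) (F : I -> A) :
  f (\prod_(i <- r | P i) F i) = \prod_(i <- r | P i) f (F i).
Proof. exact: (big_morph _ star_homM star_hom1). Qed.

Lemma star_hom_comp : star_hom (f' \o f).
Proof.
case: hf hf' => [l1 [o1 m1] s1] [l2 [o2 m2] s2].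
split=> [k x y||x] /=; [by rewrite l1 l2| split=> [|x y] /= |by rewrite s1 s2].
  by rewrite o1 o2.
by rewrite m1 m2.
Qed.

Lemma star_iso_comp : star_iso f -> star_iso f' -> star_iso (f' \o f).
Proof. by case=> _ bf [_ bf']; split; [exact: star_hom_comp|exact: bij_comp]. Qed.

End StarHom.

Lemma star_hom_id (R : realType) (A : starAlgType R) : star_hom (@id A).
Proof. by split=> //; split. Qed.

(** * Range projections and atoms of a partial representation *)

Section PartialRep.
Variables (R : realType) (gT : finGroupType) (G : {group gT}).
Variables (B : cstarAlgType R) (v : gT -> B).
Hypothesis hv : partial_rep G v.
Implicit Types (g h k : gT) (t : {set gT}).

Let v1 : v 1%g = 1. Proof. by case: hv. Qed.

Let vV g : g \in G -> star (v g) = v g^-1%g.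
Proof. by case: hv => _ h _ /h. Qed.

Let v_r g h : g \in G -> h \in G ->
  v g * v h * v h^-1%g = v (g * h)%g * v h^-1%g.
Proof. by case: hv => _ _; apply. Qed.

(** The adjoint of the defining relation. *)
Let v_l g h : g \in G -> h \in G ->
  v g^-1%g * (v g * v h) = v g^-1%g * v (g * h)%g.
Proof.
move=> gG hG; have := v_r (groupVr hG) (groupVr gG).
move/(congr1 star); rewrite !starM !vV ?groupM ?groupV // !invgK.
by rewrite invMg !invgK mulrA.
Qed.

(** The value 0 outside G makes the atom of a subset not contained in G vanish,
    and lets products and sums range over the whole of gT. *)
Definition range_proj h : B := if h \in G then v h * v h^-1%g else 0.
Local Notation e := range_proj.

Lemma range_proj_shift g h : g \in G -> v g * e h = e (g * h)%g * v g.
Proof.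
move=> gG; rewrite /e groupMl //; case: ifPn => hG; last by rewrite mulr0 mul0r.
have := v_l (groupVr (groupM gG hG)) gG.
rewrite invgK invMg -mulgA mulVg mulg1 => l.
by rewrite -mulrA l mulrA v_r.
Qed.

Lemma range_proj1 : e 1%g = 1.
Proof. by rewrite /e group1 invg1 v1 mulr1. Qed.

Lemma range_proj_idem h : e h * e h = e h.
Proof.
have [hG|hG] := boolP (h \in G); last by rewrite /e (negPf hG) mul0r.
have eh : e h = v h * v h^-1%g by rewrite /e hG.
rewrite {2 3}eh mulrA; congr (_ * _).
by have := range_proj_shift 1%g hG; rewrite mulg1 range_proj1 mulr1.
Qed.

Lemma star_range_proj h : star (e h) = e h.
Proof.
rewrite /e; case: ifPn => hG; last exact: star0.
by rewrite starM !vV ?groupV // invgK.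
Qed.

(** Moving e_h through v g and v g^-1 translates h forth and back. *)
Lemma range_proj_comm g h : e g * e h = e h * e g.
Proof.
rewrite {1 4}/e; case: ifPn => gG; last by rewrite mul0r mulr0.
by rewrite -mulrA range_proj_shift ?groupV // mulrA range_proj_shift // mulKVg
  mulrA.
Qed.

Definition atom_factor t h : B := if h \in t then e h else 1 - e h.
Definition atom t : B := \prod_h atom_factor t h.
Local Notation P := atom.

Let e_factor h t k : e h * atom_factor t k = atom_factor t k * e h.
Proof.
rewrite /atom_factor; case: ifP => _; first exact: range_proj_comm.
by rewrite mulrBl mulrBr mulr1 mul1r range_proj_comm.
Qed.

Let e_factor_diag h t : e h * atom_factor t h = atom_factor t h *+ (h \in t).
Proof.
rewrite /atom_factor; case: ifP => _ /=; first exact: range_proj_idem.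
by rewrite mulrBr mulr1 range_proj_idem subrr.
Qed.

Lemma range_proj_atom_comm h t : e h * P t = P t * e h.
Proof.
by apply: commr_prod => k _; exact: e_factor.
Qed.

Lemma range_proj_atom h t : e h * P t = P t *+ (h \in t).
Proof.
rewrite /P; elim: (index_enum gT) (mem_index_enum h) => // k s IHs.
rewrite inE big_cons; case: eqP => [<- _|_ /= /IHs {}IHs].
  by rewrite mulrA e_factor_diag mulrnAl.
by rewrite mulrA e_factor -mulrA IHs mulrnAr.
Qed.

(** The atoms are products in a noncommutative ring. This characterisation by
    the eigenvalues of the range projections avoids reordering them: it yields
    orthogonality, self-adjointness and the shift rule below. *)
Lemma atom_absorbl t x : (forall h, e h * x = x *+ (h \in t)) -> P t * x = x.
Proof.
move=> hx; rewrite /P; elim: (index_enum gT) => [|k s IHs].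
  by rewrite big_nil mul1r.
rewrite big_cons -mulrA IHs /atom_factor.
by case: ifPn => kt; rewrite ?mulrBl ?mul1r hx ?kt ?(negPf kt) //= subr0.
Qed.

Lemma atom_absorbr t x : (forall h, x * e h = x *+ (h \in t)) -> x * P t = x.
Proof.
move=> hx; rewrite /P; elim: (index_enum gT) => [|k s IHs].
  by rewrite big_nil mulr1.
rewrite big_cons mulrA -[RHS]IHs; congr (_ * _).
rewrite /atom_factor.
by case: ifPn => kt; rewrite ?mulrBr ?mulr1 hx ?kt ?(negPf kt) //= subr0.
Qed.

Lemma atom_orth t s : P t * P s = P s *+ (t == s).
Proof.
have [->|ts] := eqVneq; first by apply: atom_absorbl => h; exact: range_proj_atom.
have [h ht] : exists h, (h \in t) != (h \in s).
  apply/existsP; apply: contraNT ts => /existsPn ts.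
  by apply/eqP/setP => h; have := ts h; rewrite negbK => /eqP.
have := mulrA (P t) (e h) (P s).
rewrite -range_proj_atom_comm !range_proj_atom mulrnAr mulrnAl.
by case: (h \in t) (h \in s) ht => [] [].
Qed.

Lemma star_atom t : star (P t) = P t.
Proof.
have : P t * star (P t) = star (P t).
  apply: atom_absorbl => h; rewrite -{1}star_range_proj -starM.
  rewrite -range_proj_atom_comm range_proj_atom.
  by case: (h \in t); rewrite ?star0.
move=> h; have := congr1 star h.
by rewrite starM starK h.
Qed.

(** Both sides equal P (g *: t) * v g * P t: the range projections act on
    v g * P t from the left with the eigenvalues of g *: t, and on
    P (g *: t) * v g from the right with those of t. *)
Lemma atom_shift g t : g \in G -> v g * P t = P (g *: t)%g * v g.
Proof.
move=> gG; transitivity (P (g *: t)%g * (v g * P t)).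
  symmetry; apply: atom_absorbl => h.
  have -> : h = (g * (g^-1 * h))%g by rewrite mulKVg.
  rewrite mulrA -range_proj_shift // -mulrA range_proj_atom.
  by rewrite mem_lcoset mulKg mulrnAr.
rewrite mulrA; apply: atom_absorbr => h.
rewrite -mulrA range_proj_shift // mulrA -range_proj_atom_comm range_proj_atom.
by rewrite mem_lcoset mulKg mulrnAl.
Qed.

(** Expand the product of the sums e_h + (1 - e_h). *)
Lemma sum_atom : \sum_t P t = 1.
Proof.
have -> : 1 = \prod_(h : gT) (e h + (1 - e h)) :> B.
  by rewrite big1 // => h _; rewrite addrC subrK.
by rewrite bigA_distr; apply: eq_bigl => t; rewrite inE.
Qed.

Lemma atom_eq0 t : ~~ ((t \subset G) && (1%g \in t)) -> P t = 0.
Proof.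
rewrite negb_and => /orP[/subsetPn[h ht hG]|t1].
  by have := range_proj_atom h t; rewrite ht /e (negPf hG) mul0r.
by have := range_proj_atom 1%g t; rewrite (negPf t1) range_proj1 mul1r.
Qed.

Lemma rep_atom_eq0 g t : g \in G -> g^-1%g \notin t -> v g * P t = 0.
Proof.
move=> gG gt; have -> : v g = v g * e g^-1%g.
  by rewrite range_proj_shift // mulgV range_proj1 mul1r.
by rewrite -mulrA range_proj_atom (negPf gt) mulr0.
Qed.

(** On an atom whose index contains h^-1 the partial representation is
    multiplicative, since that atom lies under e_(h^-1). *)
Lemma rep_rep_atom g h t : g \in G -> h \in G -> h^-1%g \in t ->
  v g * v h * P t = v (g * h)%g * P t.
Proof.
move=> gG hG ht; have -> : P t = e h^-1%g * P t by rewrite range_proj_atom ht.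
rewrite /e groupV hG invgK !mulrA; congr (_ * _ * _); exact: v_r.
Qed.

End PartialRep.

(** * Generators of the convolution algebra *)

Arguments conv_val : simpl never.

Section Generators.
Variables (R : realType) (gT : finGroupType) (T : {set {set gT}}).
Variable hT : par_invariant T.
Local Notation L := (conv R hT).
Implicit Types (g h k : gT) (t : {set gT}).

(** The sum of all arrows labelled by g. *)
Definition conv_gen g : L := mk_conv hT (fun k _ => (k == g)%:R).
Definition conv_delta g t : L :=
  mk_conv hT (fun k s => ((k == g) && (s == t))%:R).

Lemma conv_sumE I (r : seq I) (P : pred I) (F : I -> L) p :
  (\sum_(i <- r | P i) F i) p = \sum_(i <- r | P i) F i p.
Proof. by elim/big_rec2: _ => [|i y x _ <-]; rewrite ?convDE // ffunE. Qed.

Lemma conv_expand (a : L) :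
  a = \sum_t \sum_g a (g, t) *: conv_delta g t.
Proof.
apply: conv_ext => k s.
rewrite conv_sumE (bigD1 s) //= [X in _ + X]big1 => [|t ts].
  rewrite addr0 conv_sumE (bigD1 k) //= big1 => [|g gk].
    rewrite addr0 convZE mk_convE !eqxx.
    by case: ifPn; rewrite ?mulr1 // => /conv_out->; rewrite mul0r.
  rewrite convZE mk_convE [k == g]eq_sym (negPf gk).
  by case: ifP; rewrite mulr0.
rewrite conv_sumE big1 // => g _; rewrite convZE mk_convE [s == t]eq_sym (negPf ts).
by rewrite andbF; case: ifP; rewrite mulr0.
Qed.

Lemma conv_gen_mul g (a : L) k t :
  (conv_gen g * a) (k, t) = if arrow T (k, t) then a ((g^-1 * k)%g, t) else 0.
Proof.
case: ifPn => [kt|]; last exact: conv_out.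
rewrite conv_mulE (bigD1 (g^-1 * k)%g) //= big1 => [|m mk].
  rewrite addr0 mk_convE invMg invgK mulKVg eqxx.
  have [h|nh] := boolP (arrow T ((g^-1 * k)%g, t)); last first.
    by rewrite (conv_out a nh) mulr0.
  case: ifPn => [_|]; first by rewrite mul1r.
  rewrite /arrow /= (arrow_target hT h) mem_lcoset invMg invgK mulgK.
  by case/andP: kt => _ ->.
rewrite mk_convE; have [kg|_] := eqVneq _ g; last by case: ifP; rewrite mul0r.
by rewrite -kg invMg invgK mulgVK eqxx in mk.
Qed.

Lemma conv_gen1 : conv_gen 1%g = 1.
Proof. by []. Qed.

Lemma star_conv_gen g : star (conv_gen g) = conv_gen g^-1%g.
Proof.
apply: conv_ext => k t; rewrite conv_starE !mk_convE (arrow_inv hT) -eq_invg_sym.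
by case: ifP; rewrite ?conjc0 // conjc_nat.
Qed.

Lemma conv_range_proj_mul h (a : L) k t :
  (conv_gen h * (conv_gen h^-1%g * a)) (k, t) =
  if arrow T ((h^-1 * k)%g, t) then a (k, t) else 0.
Proof.
rewrite !conv_gen_mul invgK mulKVg.
have [//|nk] := boolP (arrow T (k, t)); rewrite (conv_out a nk).
by case: ifP.
Qed.

Lemma conv_gen_delta g t :
  arrow T (g, t) -> conv_gen g * conv_delta 1%g t = conv_delta g t.
Proof.
move=> gt; apply: conv_ext => k s; rewrite conv_gen_mul !mk_convE.
case: ifP => // ks; rewrite -eq_mulVg1 [g == k]eq_sym.
case: andP => [[/eqP-> /eqP->]|]; last by case: ifP.
by rewrite mulVg (arrow1 hT); case/andP: gt => ->.
Qed.

End Generators.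

(** * The universal partial representation *)

Section ParTuples.
Variables (R : realType) (gT : finGroupType) (G : {group gT}).

Definition par_tuples : {set {set gT}} :=
  [set t : {set gT} | (t \subset G) && (1%g \in t)].

Lemma par_tuples_invariant : par_invariant par_tuples.
Proof.
split=> [|t|t].
- by apply/set0Pn; exists [set 1%g]; rewrite inE sub1set group1 set11.
- by rewrite inE => /andP[].
- rewrite inE => /andP[tG _] g gt; rewrite inE mem_lcoset mulg1 gt andbT.
  have gG : g \in G by rewrite -groupV (subsetP tG).
  apply/subsetP => h; rewrite mem_lcoset => /(subsetP tG).
  by rewrite groupMl ?groupV.
Qed.

Local Notation T := par_tuples.
Local Notation hT := par_tuples_invariant.
Local Notation L := (conv R hT).

Lemma par_tuples_arrow g t : arrow T (g, t) -> g \in G.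
Proof.
by case/andP; rewrite inE /= => /andP[tG _] /(subsetP tG); rewrite groupV.
Qed.

Lemma conv_gen_partial_rep : partial_rep G (conv_gen R hT).
Proof.
split=> [|g _|g h _ _]; [exact: conv_gen1 | by rewrite star_conv_gen |].
rewrite -mulrA; apply: conv_ext => k t; rewrite !conv_gen_mul !mk_convE.
rewrite invMg -mulgA; case: ifP => // kt.
have [e|ne] := eqVneq (h^-1 * (g^-1 * k))%g h^-1%g; last by do !case: ifP.
have /eqP <- : g == k.
  by rewrite eq_mulVg1 -(inj_eq (mulgI h^-1%g)) mulg1 e.
by rewrite mulVg (arrow1 hT); case/andP: kt => ->.
Qed.

Section Lift.
Variables (B : cstarAlgType R) (v : gT -> B).
Hypothesis hv : partial_rep G v.

Definition par_lift (a : L) : B := \sum_t \sum_g a (g, t) *: (v g * atom G v t).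

Lemma par_lift_hom : star_hom par_lift.
Proof.
split=> [k a b||a].
- rewrite scaler_sumr -big_split; apply: eq_bigr => t _ /=.
  rewrite scaler_sumr -big_split; apply: eq_bigr => g _ /=.
  by rewrite convDE convZE scalerDl scalerA.
- split=> [|a b].
    rewrite -(sum_atom G v); apply: eq_bigr => t _.
    rewrite (bigD1 1%g) //= big1 => [|g g1]; last first.
      by rewrite conv_oneE (negPf g1) scale0r.
    have [v1 _ _] := hv; rewrite conv_oneE eqxx addr0 inE v1 mul1r /=.
    by case: (boolP (_ && _)) => [_|/(atom_eq0 hv)->]; rewrite ?scale1r ?scaler0.
  rewrite /par_lift mulr_sumr; apply: eq_bigr => t _ /=.
  under eq_bigr do rewrite conv_mulE scaler_suml.
  rewrite exchange_big mulr_sumr; apply: eq_bigr => k _ /=.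
  have [kt|nkt] := boolP (arrow T (k, t)); last first.
    rewrite (conv_out b nkt) scale0r mulr0 big1 // => g _.
    by rewrite mulr0 scale0r.
  have kG := par_tuples_arrow kt; case/andP: (kt) => tT kt'.
  rewrite mulr_suml (bigD1 (k *: t)%g) //= [X in _ + X]big1 => [|s sk]; last first.
    rewrite mulr_suml big1 // => g _.
    rewrite -scalerAl -scalerAr (atom_shift hv t kG) -mulrA [X in _ * X]mulrA.
    by rewrite atom_orth // (negPf sk) mul0r mulr0 !scaler0.
  rewrite addr0 mulr_suml [LHS](reindex_inj (mulIg k)); apply: eq_bigr => g _ /=.
  rewrite mulgK -scalerAl -scalerAr scalerA.
  have [gt|ngt] := boolP (arrow T (g, (k *: t)%g)); last first.
    by rewrite (conv_out a ngt) !mul0r !scale0r.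
  have gG := par_tuples_arrow gt.
  congr (_ *: _); rewrite -(rep_rep_atom hv gG kG kt').
  by rewrite -!mulrA (atom_shift hv t kG) [X in _ = _ * X]mulrA atom_orth ?eqxx.
(* The adjoint of v g * atom t is v g^-1 * atom (g *: t), which belongs to the
   inverse arrow. *)
- have shiftK g : cancel (fun t : {set gT} => g *: t)%g (fun t => g^-1 *: t)%g.
    by move=> t; rewrite -lcosetM mulVg lcoset1.
  rewrite /par_lift star_sum; under [RHS]eq_bigr do rewrite star_sum.
  rewrite exchange_big (reindex_inj invg_inj) [RHS]exchange_big /=.
  apply: eq_bigr => g _; rewrite (reindex_inj (can_inj (shiftK g))).
  apply: eq_bigr => t _ /=; rewrite conv_starE invgK shiftK starZ_conjc.
  have [gt|ngt] := boolP (arrow T (g, t)); last first.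
    by rewrite (conv_out a ngt) conjc0 !scale0r.
  have gG := par_tuples_arrow gt; congr (_ *: _).
  by rewrite starM (star_atom hv) (atom_shift hv) ?groupV // shiftK; case: hv => _ ->.
Qed.

Lemma par_lift_gen g : g \in G -> par_lift (conv_gen R hT g) = v g.
Proof.
move=> gG; rewrite -[RHS]mulr1 -(sum_atom G v) mulr_sumr; apply: eq_bigr => t _.
rewrite (bigD1 g) //= big1 => [|k kg]; last first.
  by rewrite mk_convE (negPf kg); case: ifP; rewrite scale0r.
rewrite addr0 mk_convE eqxx; case: ifPn; first by rewrite scale1r.
rewrite scale0r /arrow inE /= negb_and => /orP[/(atom_eq0 hv)->|].
  by rewrite mulr0.
by move=> /(rep_atom_eq0 hv gG)->.
Qed.

End Lift.

(** In the convolution algebra, e_h is the sum of the units (1, s) with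
    h \in s. *)
Lemma range_proj_conv_delta h s :
  range_proj G (conv_gen R hT) h * conv_delta R hT 1%g s =
  conv_delta R hT 1%g s *+ (h \in s).
Proof.
have [sT|nsT] := boolP (s \in T); last first.
  have -> : conv_delta R hT 1%g s = 0.
    apply: conv_ext => k r; rewrite mk_convE ffunE; case: ifP => // kr.
    have [rs|_] := eqVneq r s; last by rewrite andbF.
    by move: kr nsT; rewrite /arrow /= rs => /andP[->].
  by rewrite mulr0 mul0rn.
have natE (a : L) (b : bool) p : (a *+ b) p = if b then a p else 0.
  by case: b; rewrite // ffunE.
rewrite /range_proj; case: ifPn => hG; last first.
  rewrite mul0r; suff -> : (h \in s) = false by [].
  by apply/negbTE; apply: contra hG; move: sT; rewrite inE => /andP[/subsetP s1 _] /s1.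
apply: conv_ext => k r; rewrite -mulrA conv_range_proj_mul natE mk_convE.
have [/andP[/eqP-> /eqP->]|] := boolP (_ && _); last by do !case: ifP.
by rewrite mulg1 /arrow /= sT invgK; case: ifP.
Qed.

Lemma atom_conv_gen t : atom G (conv_gen R hT) t = conv_delta R hT 1%g t.
Proof.
have sum1 : 1 = \sum_s conv_delta R hT 1%g s.
  rewrite [LHS]conv_expand; apply: eq_bigr => s _.
  rewrite (bigD1 1%g) //= big1 => [|g g1]; last first.
    by rewrite conv_oneE (negPf g1) scale0r.
  rewrite addr0; apply: conv_ext => k r; rewrite convZE conv_oneE eqxx mk_convE.
  case: ifP => [/andP[/= rT _]|]; last by rewrite mulr0.
  by have [<-|_] := eqVneq r s; rewrite ?andbF ?mulr0 // rT mul1r.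
rewrite -[LHS]mulr1 sum1 mulr_sumr (bigD1 t) //= big1 => [|s st].
  by rewrite addr0; apply: atom_absorbl => h; exact: range_proj_conv_delta.
have <- : atom G (conv_gen R hT) s * conv_delta R hT 1%g s = conv_delta R hT 1%g s.
  by apply: atom_absorbl => h; exact: range_proj_conv_delta.
by rewrite mulrA (atom_orth conv_gen_partial_rep) eq_sym (negPf st) mul0r.
Qed.

Lemma par_lift_conv_gen a : par_lift (conv_gen R hT) a = a.
Proof.
rewrite [RHS]conv_expand; apply: eq_bigr => t _; apply: eq_bigr => g _.
have [gt|ngt] := boolP (arrow T (g, t)); last by rewrite (conv_out a ngt) !scale0r.
by rewrite atom_conv_gen conv_gen_delta.
Qed.

End ParTuples.

(** * Identification with universal C*-algebras *)

Section UniversalIso.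
Variables (R : realType) (gT : finGroupType) (G : {group gT}).

(** A C*-algebra L with a representation v is universal as soon as there is a
    homomorphism h from L back to the universal algebra A that respects
    generators, and is inverted by the homomorphism f that A provides; the other
    composite is the identity by uniqueness. *)
Lemma universal_cstar_iso (rel : forall B : cstarAlgType R, (gT -> B) -> Prop)
    (A L : cstarAlgType R) (u : gT -> A) (v : gT -> L) (h : L -> A) :
    universal_cstar G rel u -> rel L v ->
    star_hom h -> {in G, forall g, h (v g) = u g} ->
    (forall f : A -> L, star_hom f -> {in G, forall g, f (u g) = v g} ->
       cancel h f) ->
  exists f : A -> L, star_iso f /\ {in G, forall g, f (u g) = v g}.
Proof.
move=> [uA univ] rv hh hv can; have [f [hf fu _]] := univ L v rv.
exists f; split=> //; split=> //.
exists h; last exact: can.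
have [i [hi iu uniq]] := univ A u uA.
have hfE : h \o f =1 i.
  by apply: uniq => [|g gG /=]; [exact: star_hom_comp | rewrite fu // hv].
have idE : id =1 i by apply: uniq => //; exact: star_hom_id.
by move=> a; exact: etrans (hfE a) (esym (idE a)).
Qed.

Lemma star_hom_atom (A B : cstarAlgType R) (u : gT -> A) (v : gT -> B)
    (f : A -> B) t :
  star_hom f -> {in G, forall g, f (u g) = v g} -> f (atom G u t) = atom G v t.
Proof.
move=> hf fu; rewrite star_hom_prod //; apply: eq_bigr => h _.
have fe : f (range_proj G u h) = range_proj G v h.
  rewrite /range_proj; case: ifPn => hG; last exact: star_hom0.
  by rewrite (star_homM hf) !fu ?groupV.
rewrite /atom_factor; case: ifP => _ //.
by rewrite (star_homB hf) (star_hom1 hf) fe.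
Qed.

Lemma partial_group_cstar_conv (A : cstarAlgType R) (u : gT -> A) :
  is_partial_group_cstar G u ->
  exists f : A -> conv R (par_tuples_invariant G), star_iso f /\
    {in G, forall g, f (u g) = conv_gen R (par_tuples_invariant G) g}.
Proof.
move=> univ; have [hu _] := univ.
apply: (universal_cstar_iso univ (conv_gen_partial_rep R G) (par_lift_hom hu)).
  exact: par_lift_gen.
move=> f hf fu a; rewrite -[RHS](par_lift_conv_gen) /par_lift star_hom_sum //.
apply: eq_bigr => t _; rewrite star_hom_sum //; apply: eq_bigr => g _.
have [gt|ngt] := boolP (arrow (par_tuples G) (g, t)); last first.
  by rewrite (conv_out a ngt) !scale0r (star_hom0 hf).
rewrite (star_homZ hf) (star_homM hf) fu ?(par_tuples_arrow gt) //.
by rewrite (star_hom_atom _ hf fu).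
Qed.

End UniversalIso.

(** * Group C*-algebras *)

Section GroupAlgebra.
Variables (R : realType) (gT : finGroupType) (H : {group gT}).

(** Translations by elements of H form the groupoid with the single object H, so
    the convolution algebra becomes the group algebra of H. *)
Definition group_tuples : {set {set gT}} := [set (H : {set gT})].

Lemma group_tuples_invariant : par_invariant group_tuples.
Proof.
split=> [|t|t]; first by apply/set0Pn; exists (H : {set gT}); rewrite set11.
  by rewrite inE => /eqP->; exact: group1.
rewrite inE => /eqP-> g; rewrite groupV => gH.
by rewrite inE lcoset_id.
Qed.

Local Notation hT := group_tuples_invariant.
Local Notation L := (conv R hT).

Lemma group_tuples_arrow g : arrow group_tuples (g, H : {set gT}) = (g \in H).
Proof. by rewrite /arrow /= set11 groupV. Qed.

Lemma conv_gen_unitary_rep : unitary_rep H (conv_gen R hT).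
Proof.
have genM : {in H &, forall g h,
    conv_gen R hT (g * h)%g = conv_gen R hT g * conv_gen R hT h}.
  move=> g h gH hH; apply: conv_ext => k t; rewrite conv_gen_mul !mk_convE.
  case: ifPn => // kt; have tH : t = H by move: kt => /andP[/set1P].
  have -> : (g^-1 * k == h)%g = (k == g * h)%g.
    by rewrite -(inj_eq (mulgI g)) mulKVg.
  have [->|_] := eqVneq k (g * h)%g; last by case: ifP.
  by rewrite mulKg tH group_tuples_arrow hH.
split=> // g gH; rewrite star_conv_gen -!genM ?groupV //.
by rewrite mulVg mulgV.
Qed.

Definition group_lift (C : cstarAlgType R) (w : gT -> C) (a : L) : C :=
  \sum_(h in H) a (h, H : {set gT}) *: w h.

Lemma unitary_rep_star (C : cstarAlgType R) (w : gT -> C) :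
  unitary_rep H w -> {in H, forall h, star (w h) = w h^-1%g}.
Proof.
move=> [w1 wM wU] h hH; have [_ e] := wU _ hH.
by rewrite -[LHS]mul1r -w1 -(mulVg h) wM ?groupV // -mulrA e mulr1.
Qed.

Lemma group_lift_hom (C : cstarAlgType R) (w : gT -> C) :
  unitary_rep H w -> star_hom (group_lift w).
Proof.
move=> hw; have [w1 wM wU] := hw; split=> [k a b||a].
- rewrite scaler_sumr -big_split; apply: eq_bigr => h _ /=.
  by rewrite convDE convZE scalerDl scalerA.
- split=> [|a b].
    rewrite /group_lift (bigD1 1%g) //= big1 => [|h /andP[_ h1]].
      by rewrite conv_oneE set11 eqxx scale1r addr0 w1.
    by rewrite conv_oneE (negPf h1) scale0r.
  have mE h : (a * b) (h, H : {set gT}) =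
      \sum_(k in H) a ((h * k^-1)%g, H : {set gT}) * b (k, H : {set gT}).
    rewrite conv_mulE [RHS]big_mkcond; apply: eq_bigr => k _.
    case: ifPn => kH; first by rewrite lcoset_id.
    by rewrite [b _]conv_out ?mulr0 // group_tuples_arrow.
  rewrite /group_lift mulr_sumr; under eq_bigr do rewrite mE scaler_suml.
  rewrite exchange_big; apply: eq_bigr => k kH /=.
  rewrite mulr_suml (reindex_inj (mulIg k)); apply: eq_big => [h|h hH].
    by rewrite groupMr.
  rewrite mulgK -scalerAl -scalerAr scalerA wM // -(groupMr _ kH) //.
- rewrite /group_lift star_sum (reindex_inj invg_inj); apply: eq_big => [h|h].
    by rewrite groupV.
  move=> hH; rewrite conv_starE invgK lcoset_id // starZ_conjc.
  by rewrite (unitary_rep_star hw) // -groupV.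
Qed.

Lemma group_lift_gen (C : cstarAlgType R) (w : gT -> C) :
  {in H, forall h, group_lift w (conv_gen R hT h) = w h}.
Proof.
move=> h hH; rewrite /group_lift (bigD1 h) //= big1 => [|k /andP[_ kh]].
  by rewrite mk_convE group_tuples_arrow hH eqxx scale1r addr0.
by rewrite mk_convE (negPf kh); case: ifP; rewrite scale0r.
Qed.

Lemma group_lift_conv_gen (a : L) : group_lift (conv_gen R hT) a = a.
Proof.
apply: conv_ext => k t.
rewrite /group_lift conv_sumE; have [kt|nkt] := boolP (arrow group_tuples (k, t)); last first.
  by rewrite (conv_out a nkt) big1 // => h _; rewrite convZE mk_convE (negPf nkt) mulr0.
have tH : t = H by move: kt => /andP[/set1P].
rewrite tH group_tuples_arrow in kt *.
rewrite (bigD1 k) //= big1 => [|h /andP[_ hk]].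
  by rewrite convZE mk_convE group_tuples_arrow kt eqxx mulr1 addr0.
by rewrite convZE mk_convE group_tuples_arrow kt eq_sym (negPf hk) mulr0.
Qed.

Lemma group_cstar_conv (C : cstarAlgType R) (w : gT -> C) :
  is_group_cstar H w ->
  exists f : C -> L, star_iso f /\ {in H, forall h, f (w h) = conv_gen R hT h}.
Proof.
move=> univ; have [hw _] := univ.
apply: (universal_cstar_iso univ conv_gen_unitary_rep (group_lift_hom hw)).
  exact: group_lift_gen.
move=> f hf fw a; rewrite -[RHS]group_lift_conv_gen star_hom_sum //.
by apply: eq_bigr => h hH; rewrite (star_homZ hf) fw.
Qed.

(** The universal property alone does not show that the w h are linearly
    independent; the convolution algebra, where they become the arrows, does. *)
Lemma group_cstar_basis (C : cstarAlgType R) (w : gT -> C) :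
  is_group_cstar H w ->
  (forall c, exists F : gT -> R[i], c = \sum_(h in H) F h *: w h) /\
  (forall F : gT -> R[i], \sum_(h in H) F h *: w h = 0 ->
     {in H, forall h, F h = 0}).
Proof.
move=> univ; have [f [[hf [f' fK f'K]] fw]] := group_cstar_conv univ.
have fsum (F : gT -> R[i]) : f (\sum_(h in H) F h *: w h) =
    mk_conv hT (fun h _ => F h).
  rewrite -[RHS]group_lift_conv_gen star_hom_sum //; apply: eq_bigr => h hH.
  by rewrite (star_homZ hf) fw // mk_convE group_tuples_arrow hH.
split=> [c|F F0 h hH].
  exists (fun h => f c (h, H : {set gT})); apply: (can_inj fK); rewrite fsum.
  apply: conv_ext => k t; rewrite mk_convE; case: ifPn => [|/conv_out-> //].
  by case/andP => /= /set1P->.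
have := fsum F; rewrite F0 (star_hom0 hf) => /(congr1 (fun a : L => a (h, H : {set gT}))).
by rewrite mk_convE group_tuples_arrow hH ffunE => <-.
Qed.

End GroupAlgebra.

(** * The matrix component of an orbit *)

Section Component.
Variables (R : realType) (gT : finGroupType) (G : {group gT}).
Local Notation T := (par_tuples G).
Local Notation L := (conv R (par_tuples_invariant G)).
Variables (tau : {set gT}) (m : nat) (x : 'I_m.+1 -> gT).
Local Notation K := (lstab_group G tau).
Local Notation s := (fun j => (x j)^-1 *: tau)%g.
Hypothesis tauT : tau \in T.
Hypothesis x_inj : injective (fun i => K :* x i)%g.
Hypothesis x_cover : [set (K :* x i)%g | i : 'I_m.+1] = rcosets K tau.

Lemma lstab_lcoset h : h \in K -> (h *: tau = tau)%g.
Proof. by rewrite inE => /andP[_ /eqP]. Qed.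

Lemma lstab_mul h y : h \in K -> (h * y \in tau)%g = (y \in tau).
Proof.
by move=> hK; rewrite -{1}(lstab_lcoset hK) mem_lcoset mulKg.
Qed.

Lemma rep_mem i : x i \in tau.
Proof.
have : (K :* x i)%g \in rcosets K tau by rewrite -x_cover; apply/imsetP; exists i.
case/rcosetsP => y yt e.
have : x i \in (K :* y)%g by rewrite -e rcoset_refl.
by case/rcosetP => h hK ->; rewrite lstab_mul.
Qed.

Lemma rep_ex y : y \in tau -> exists i, (y * (x i)^-1 \in K)%g.
Proof.
move=> yt; have : (K :* y)%g \in rcosets K tau by apply/rcosetsP; exists y.
rewrite -x_cover => /imsetP[i _ e]; exists i.
by rewrite -mem_rcoset -e rcoset_refl.
Qed.

Lemma rep_mulV_mem i j : (x i * (x j)^-1 \in K)%g = (i == j).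
Proof.
apply/idP/eqP => [h|->]; last by rewrite mulgV group1.
by apply: x_inj; apply/rcoset_eqP; rewrite mem_rcoset.
Qed.

Lemma orbit_tupleT j : s j \in T.
Proof.
apply: (arrow_target (par_tuples_invariant G)).
by rewrite /arrow /= tauT invgK rep_mem.
Qed.

Lemma component_arrow i j h : h \in K ->
  arrow T (((x i)^-1 * h * x j)%g, s j).
Proof.
move=> hK; rewrite /arrow /= orbit_tupleT !invMg !invgK mem_lcoset invgK mulKVg.
by rewrite lstab_mul ?groupV // rep_mem.
Qed.

Lemma component_shift i j h : h \in K ->
  ((x i)^-1 * h * x j *: s j = s i)%g.
Proof.
by move=> hK; rewrite -lcosetM mulgK lcosetM lstab_lcoset.
Qed.

(** The arrows out of (x l)^-1 *: tau are the (x j)^-1 * h * x l with h \in K: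
    such an arrow k satisfies x l * k^-1 \in tau, and tau is the disjoint union of
    the cosets K :* x j. *)
Lemma sum_reps (V : zmodType) (F : gT -> V) l :
    (forall k, ~~ arrow T (k, s l) -> F k = 0) ->
  \sum_k F k = \sum_j \sum_(h in K) F ((x j)^-1 * h * x l)%g.
Proof.
move=> F0; transitivity (\sum_k \sum_j if (x j * k * (x l)^-1 \in K)%g then F k else 0).
  apply: eq_bigr => k _.
  have [kl|nkl] := boolP (arrow T (k, s l)); last first.
    by rewrite F0 // big1 // => j _; case: ifP.
  have kE j : (x j * k * (x l)^-1 \in K)%g = (x l * k^-1 * (x j)^-1 \in K)%g.
    by rewrite -groupV !invMg invgK mulgA.
  have [j jK] : exists j, (x l * k^-1 * (x j)^-1 \in K)%g.
    by apply: rep_ex; case/andP: kl => /= _; rewrite mem_lcoset invgK.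
  rewrite (bigD1 j) //= kE jK big1 ?addr0 // => i ij; rewrite kE.
  case: ifP => // iK; case/negP: ij; rewrite -rep_mulV_mem.
  have -> : (x i * (x j)^-1 = (x l * k^-1 * (x i)^-1)^-1 * (x l * k^-1 * (x j)^-1))%g.
    by rewrite [((_ * (x i)^-1)^-1)%g]invMg invgK -mulgA mulKg.
  by rewrite groupM ?groupV.
rewrite exchange_big; apply: eq_bigr => j _ /=.
rewrite (reindex_inj (mulgI (x j)^-1%g)) (reindex_inj (mulIg (x l))) /=.
rewrite [RHS]big_mkcond; apply: eq_bigr => h _.
by rewrite !mulgA mulgV mul1g mulgK.
Qed.

Variables (C : cstarAlgType R) (w : gT -> C).
Hypothesis hw : unitary_rep K w.

Definition component (a : L) : starmx C m :=
  \matrix_(i, j) \sum_(h in K) a (((x i)^-1 * h * x j)%g, s j) *: w h.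

Lemma component_hom : star_hom component.
Proof.
have [w1 wM wU] := hw; split=> [k a b||a].
- apply/matrixP => i j; rewrite !mxE scaler_sumr -big_split; apply: eq_bigr => h _ /=.
  by rewrite convDE convZE scalerDl scalerA.
- split=> [|a b].
    apply/matrixP => i j; rewrite !mxE.
    have oneE h : h \in K -> (1 : L) (((x i)^-1 * h * x j)%g, s j) =
        (h == x i * (x j)^-1)%g%:R.
      move=> hK; rewrite conv_oneE orbit_tupleT andbT; congr (_%:R).
      by rewrite -(inj_eq (mulgI (x i))) -(inj_eq (mulIg (x j)^-1%g)) mulgA mulKVg mulgK mulg1.
    rewrite (eq_bigr (fun h => (h == x i * (x j)^-1)%g%:R *: w h)) => [|h hK]; last by rewrite oneE.
    have [<-|ij] := eqVneq i j.
      rewrite mulgV (bigD1 1%g) //= eqxx scale1r w1 big1 ?addr0 // => h /andP[_ h1].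
      by rewrite (negPf h1) scale0r.
    rewrite big1 // => h hK; case: eqP => [e|_]; last by rewrite scale0r.
    by rewrite e rep_mulV_mem (negPf ij) in hK.
  apply/matrixP => i l; rewrite !mxE.
  have mE h : h \in K -> (a * b) (((x i)^-1 * h * x l)%g, s l) =
      \sum_j \sum_(h' in K) a (((x i)^-1 * (h * h'^-1) * x j)%g, s j)
                         * b (((x j)^-1 * h' * x l)%g, s l).
    move=> hK; rewrite conv_mulE (sum_reps (l := l)) => [|k nk]; last first.
      by rewrite (conv_out b nk) mulr0.
    apply: eq_bigr => j _; apply: eq_bigr => h' hK'.
    rewrite component_shift //; congr (a (_, _) * _).
    by rewrite !invMg invgK !mulgA mulgK.
  rewrite (eq_bigr _ (fun h hK => congr1 (fun c => c *: w h) (mE h hK))).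
  under eq_bigr do rewrite scaler_suml.
  rewrite exchange_big; apply: eq_bigr => j _ /=; rewrite !mxE.
  rewrite mulr_sumr; under eq_bigr do rewrite scaler_suml.
  rewrite exchange_big; apply: eq_bigr => h' hK' /=.
  rewrite mulr_suml (reindex_inj (mulIg h')); apply: eq_big => [h|h hK].
    by rewrite groupMr.
  by rewrite mulgK -scalerAl -scalerAr scalerA wM // -(groupMr _ hK').
- apply/matrixP => i j; rewrite !mxE star_sum (reindex_inj invg_inj).
  apply: eq_big => [h|h]; first by rewrite groupV.
  rewrite groupV => hK; rewrite conv_starE starZ_conjc (unitary_rep_star hw) //.
  by rewrite component_shift ?groupV // !invMg !invgK mulgA.
Qed.

Lemma component_gen g : component (conv_gen R (par_tuples_invariant G) g) =
  \matrix_(i, j) let h := (x i * g * (x j)^-1)%g in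
                 if h \in lstab G tau then w h else 0.
Proof.
apply/matrixP => i j; rewrite !mxE /=.
have eqE h : ((x i)^-1 * h * x j == g)%g = (h == x i * g * (x j)^-1)%g.
  by rewrite -(inj_eq (mulgI (x i))) -(inj_eq (mulIg (x j)^-1%g)) !mulgA mulgV mul1g mulgK.
case: ifPn => gK.
  rewrite (bigD1 (x i * g * (x j)^-1)%g) //= big1 => [|h /andP[hK hg]].
    by rewrite mk_convE component_arrow // eqE eqxx scale1r addr0.
  by rewrite mk_convE eqE (negPf hg); case: ifP; rewrite scale0r.
rewrite big1 // => h hK; rewrite mk_convE eqE.
case: eqP => [e|_]; last by case: ifP; rewrite scale0r.
by rewrite e (negPf gK) in hK.
Qed.

End Component.

(** * Maps into a direct sum *)

Section Dsum.
Variables (R : realType) (I : finType) (I_gt0 : (0 < #|I|)%N).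
Variables (A : starAlgType R) (B : I -> starAlgType R) (f : forall i, A -> B i).

Definition dsum_map (a : A) : dsum I_gt0 B := [ffun i => f i a].

Lemma dsum_map_hom : (forall i, star_hom (f i)) -> star_hom dsum_map.
Proof.
move=> hf; split=> [k a b||a]; last 1 first.
- by apply/ffunP => i; rewrite !ffunE; case: (hf i).
- by apply/ffunP => i; rewrite !ffunE; case: (hf i) => ->.
split=> [|a b]; apply/ffunP => i; rewrite !ffunE.
  by rewrite (star_hom1 (hf i)).
by rewrite (star_homM (hf i)).
Qed.

End Dsum.

(** * Orbits of tuples *)

Section Orbits.
Variables (gT : finGroupType) (G : {group gT}).
Implicit Types (n : nat) (t : {set gT}).

Lemma ntuples_par n t : t \in ntuples G n -> t \in par_tuples G.
Proof. by rewrite !inE => /and3P[-> ->]. Qed.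

Lemma par_orbit_relP n t t' : t \in ntuples G n ->
  reflect (exists2 k, k^-1%g \in t & t' = (k *: t)%g) (par_orbit_rel G t t').
Proof.
rewrite inE => /and3P[/subsetP tG _ _].
apply: (iffP exists_inP) => [[k kG /andP[kt /eqP->]]|[k kt ->]]; exists k => //.
  by rewrite -groupV tG.
by rewrite kt eqxx.
Qed.

Lemma par_orbit_equiv n :
  {in ntuples G n & &, equivalence_rel (par_orbit_rel G)}.
Proof.
have sym t t' : t \in ntuples G n -> t' \in ntuples G n ->
    par_orbit_rel G t t' -> par_orbit_rel G t' t.
  move=> tn tn' /(par_orbit_relP _ tn)[k kt e]; apply/(par_orbit_relP _ tn').
  exists k^-1%g; last by rewrite e -lcosetM mulVg lcoset1.
  by rewrite invgK e mem_lcoset mulVg; move: tn; rewrite inE => /and3P[].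
have trans t t' t'' : t \in ntuples G n -> t' \in ntuples G n ->
    par_orbit_rel G t t' -> par_orbit_rel G t' t'' -> par_orbit_rel G t t''.
  move=> tn tn' /(par_orbit_relP _ tn)[k kt e] /(par_orbit_relP _ tn')[h ht ->].
  apply/(par_orbit_relP _ tn); exists (h * k)%g; last by rewrite e lcosetM.
  by rewrite invMg; move: ht; rewrite e mem_lcoset.
move=> t t' t'' tn tn' tn''; split=> [|tt'].
  apply/(par_orbit_relP _ tn''); exists 1%g; last by rewrite lcoset1.
  by rewrite invg1; move: tn''; rewrite inE => /and3P[].
by apply/idP/idP; apply: trans => //; exact: sym.
Qed.

Lemma orbits_partition n : partition (orbits G n) (ntuples G n).
Proof. exact: equivalence_partitionP (@par_orbit_equiv n). Qed.

Lemma mem_orbit_type n (z : orbit_type G n) t : t \in val z -> t \in ntuples G n.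
Proof.
move=> tz; rewrite -(cover_partition (orbits_partition n)).
by apply/bigcupP; exists (val z) => //; exact: valP.
Qed.

Lemma pblock_orbit n (z : orbit_type G n) t :
  t \in val z -> pblock (orbits G n) t = val z.
Proof.
apply: def_pblock; last exact: valP.
by case/and3P: (orbits_partition n).
Qed.

Lemma mem_orbitE n (z : orbit_type G n) t t' : t \in val z ->
  t' \in ntuples G n -> (t' \in val z) = par_orbit_rel G t t'.
Proof.
move=> tz tn'; rewrite -(pblock_orbit tz).
exact: (pblock_equivalence_partition (@par_orbit_equiv n) (mem_orbit_type tz) tn').
Qed.

Lemma mem_orbit n (z : orbit_type G n) t y : t \in val z -> y \in t ->
  (y^-1 *: t)%g \in val z.
Proof.
move=> tz yt; have tn := mem_orbit_type tz.
have tn' : (y^-1 *: t)%g \in ntuples G n.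
  have tT := ntuples_par tn.
  have : (y^-1 *: t)%g \in par_tuples G.
    apply: (arrow_target (par_tuples_invariant G)).
    by rewrite /arrow /= tT invgK.
  rewrite !inE => /andP[-> ->] /=; rewrite card_lcoset.
  by move: tn; rewrite inE => /and3P[].
rewrite (mem_orbitE tz tn'); apply/(par_orbit_relP _ tn).
by exists y^-1%g; rewrite ?invgK.
Qed.

Lemma mem_orbit_inj n (z z' : orbit_type G n) t :
  t \in val z -> t \in val z' -> z = z'.
Proof.
by move=> /pblock_orbit e /pblock_orbit e'; apply: val_inj; rewrite /= -e -e'.
Qed.

Lemma ex_orbit t : t \in par_tuples G ->
  exists (n : 'I_#|G|) (z : orbit_type G n.+1), t \in val z.
Proof.
rewrite inE => /andP[tG t1].
have t0 : (0 < #|t|)%N by apply/card_gt0P; exists 1%g.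
have tn : (#|t|.-1 < #|G|)%N by rewrite prednK // subset_leq_card.
exists (Ordinal tn); have tnt : t \in ntuples G (Ordinal tn).+1.
  by rewrite inE tG t1 /= prednK.
have tc : t \in cover (orbits G (Ordinal tn).+1).
  by rewrite (cover_partition (orbits_partition _)).
exists (exist (fun z => z \in orbits G (Ordinal tn).+1) _ (pblock_mem tc)).
by rewrite /= mem_pblock.
Qed.

End Orbits.

(** * Enumeration of the arrows by orbits, matrix entries and stabilisers *)

Section Indexing.
Variables (gT : finGroupType) (G : {group gT}).
Unset Implicit Arguments.
Variables (tau : forall n : nat, orbit_type G n -> {set gT})
    (tau_rep : forall (n : nat) (z : orbit_type G n), tau n z \in val z)
    (x : forall (n : nat) (z : orbit_type G n), 'I_(mindex G n (tau n z)).+1 -> gT)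
    (x_reps : forall (n : nat) (z : orbit_type G n), rcoset_reps (x n z)).
Set Implicit Arguments.

Lemma tau_par n (z : orbit_type G n) : tau _ z \in par_tuples G.
Proof. exact: ntuples_par (mem_orbit_type (tau_rep _ z)). Qed.

(** The arrow from (x j)^-1 *: tau to (x i)^-1 *: tau that corresponds to the
    element h of the isotropy group at tau. *)
Definition component_index n (z : orbit_type G n) i j h : gT * {set gT} :=
  (((x _ z i)^-1 * h * x _ z j)%g, ((x _ z j)^-1 *: tau _ z)%g).
Arguments component_index [n] z i j h.

Lemma component_index_arrow n (z : orbit_type G n) i j h : h \in lstab G (tau n z) ->
  arrow (par_tuples G) (component_index z i j h).
Proof.
have [inj cov] := x_reps _ z.
exact: (component_arrow (tau_par z) cov).
Qed.

Lemma component_index_surj p : arrow (par_tuples G) p ->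
  exists (n : 'I_#|G|) (z : orbit_type G n.+1) i j h,
    h \in lstab G (tau _ z) /\ p = component_index z i j h.
Proof.
case: p => g t /andP/= [tT gt]; have [n [z tz]] := ex_orbit tT.
have [inj cov] := x_reps _ z; have tauz := tau_rep _ z.
move: (tz); rewrite (mem_orbitE tauz (mem_orbit_type tz)).
move=> /(par_orbit_relP _ (mem_orbit_type tauz))[k kt e].
have [j jK] := rep_ex cov kt.
have {}e : t = ((x _ z j)^-1 *: tau _ z)%g.
  have tk := lstab_lcoset (groupVr jK).
  by rewrite e -[in X in _ = X]tk -lcosetM invMg !invgK mulKg.
have yt : (x n.+1 z j * g^-1)%g \in tau n.+1 z.
  by rewrite e mem_lcoset invgK in gt.
have [i iK] := rep_ex cov yt.
exists n, z, i, j, (x n.+1 z i * g * (x n.+1 z j)^-1)%g; split.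
  by move: iK; rewrite -groupV !invMg !invgK mulgA.
by rewrite /component_index -e !mulgA mulVg mul1g mulgKV.
Qed.

(** Injectivity of [component_index], in a form that avoids an equality between
    dependent tuples: any family F of values is a function of the arrow. *)
Lemma component_index_inj (V : Type)
    (F : forall (n : 'I_#|G|) (z : orbit_type G n.+1),
       'I_(mindex G n.+1 (tau _ z)).+1 -> 'I_(mindex G n.+1 (tau _ z)).+1 ->
       gT -> V)
    (n n' : 'I_#|G|) (z : orbit_type G n.+1) (z' : orbit_type G n'.+1) i j h i' j' h' :
  h \in lstab G (tau _ z) -> h' \in lstab G (tau _ z') ->
  component_index z i j h = component_index z' i' j' h' ->
  F n z i j h = F n' z' i' j' h'.
Proof.
move=> hK hK' [eg et].
have sz : ((x _ z j)^-1 *: tau _ z)%g \in val z.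
  by apply: mem_orbit; [exact: tau_rep | exact: (rep_mem (x_reps _ z).2)].
have sz' : ((x _ z' j')^-1 *: tau _ z')%g \in val z'.
  by apply: mem_orbit; [exact: tau_rep | exact: (rep_mem (x_reps _ z').2)].
have nn : n = n'.
  have := mem_orbit_type sz; have := mem_orbit_type sz'.
  rewrite et !inE => /and3P[_ _ /eqP->] /and3P[_ _]; rewrite eqSS => /eqP e.
  exact/val_inj/esym.
subst n'; rewrite -et in sz'; have zz := mem_orbit_inj sz sz'; subst z'.
have [inj cov] := x_reps _ z; have KE := rep_mulV_mem inj.
have /subsetP tG : tau _ z \subset G.
  by have := tau_par z; rewrite inE => /andP[].
have xG l : x _ z l \in G by apply: tG; exact: rep_mem cov l.
have jj : j = j'.
  apply/eqP; rewrite -KE inE groupM ?groupV //=; apply/eqP.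
  by rewrite lcosetM -et -lcosetM mulgV lcoset1.
subst j'; have {}eg := mulIg _ _ _ eg.
have ii : i = i'.
  apply/eqP; rewrite -KE; have -> : (x _ z i * (x _ z i')^-1 = h * h'^-1)%g.
    by rewrite -[h](mulKVg (x _ z i)) eg !mulgA mulgK.
  by rewrite groupM ?groupV.
by subst i'; rewrite (mulgI _ _ _ eg).
Qed.

End Indexing.

Arguments component_index {gT G tau} x {n} z i j h.

(** * The isomorphism *)

Lemma injective_surjective_bijective (A B : choiceType) (f : A -> B) :
  injective f -> (forall b, exists a, f a = b) -> bijective f.
Proof.
move=> inj surj; have surj' b : exists a, f a == b.
  by have [a <-] := surj b; exists a.
have fK b : f (xchoose (surj' b)) = b by exact/eqP/(xchooseP (surj' b)).
by exists (fun b => xchoose (surj' b)) => // a; apply: inj.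
Qed.

Local Close Scope complex_scope.
Unset Implicit Arguments.
Set Strict Implicit.
Set Printing Implicit Defensive.

Theorem theorem5p2 (R : realType) (gT : finGroupType) (G : {group gT})
    (A : cstarAlgType R) (u : gT -> A)
    (u_univ : is_partial_group_cstar G u)
    (CH : {group gT} -> cstarAlgType R) (w : forall H : {group gT}, gT -> CH H)
    (w_univ : forall H : {group gT}, is_group_cstar H (w H))
    (tau : forall n : nat, orbit_type G n -> {set gT})
    (tau_rep : forall (n : nat) (z : orbit_type G n), tau n z \in val z)
    (x : forall (n : nat) (z : orbit_type G n), 'I_(mindex G n (tau n z)).+1 -> gT)
    (x_reps : forall (n : nat) (z : orbit_type G n), rcoset_reps (x n z)) :
  exists phi : A ->
      dsum (ord_gt0 G) (fun n : 'I_#|G| =>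
        dsum (orbit_type_gt0 n) (fun z : orbit_type G n.+1 =>
          starmx (CH (lstab_group G (tau n.+1 z))) (mindex G n.+1 (tau n.+1 z)))),
    star_iso phi /\
    {in G, forall g (n : 'I_#|G|) (z : orbit_type G n.+1),
       phi (u g) n z =
       \matrix_(i, j)
         let h := (x n.+1 z i * g * (x n.+1 z j)^-1)%g in
         if h \in lstab G (tau n.+1 z)
         then w (lstab_group G (tau n.+1 z)) h else 0}.
Proof.
have [f [fiso fu]] := partial_group_cstar_conv u_univ.
pose L := conv R (par_tuples_invariant G).
pose K n (z : orbit_type G n) := lstab_group G (tau n z).
pose M (n : 'I_#|G|) (z : orbit_type G n.+1) : L -> _ :=
  component (tau n.+1 z) (x n.+1 z) (w (K n.+1 z)).
pose Phi : L -> dsum (ord_gt0 G) (fun n : 'I_#|G| =>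
        dsum (orbit_type_gt0 n) (fun z : orbit_type G n.+1 =>
          starmx (CH (lstab_group G (tau n.+1 z))) (mindex G n.+1 (tau n.+1 z)))) :=
  dsum_map (ord_gt0 G) (fun n : 'I_#|G| => dsum_map (orbit_type_gt0 n) (M n)).
have PhiE a n z : Phi a n z = M n z a by rewrite !ffunE.
have hPhi : star_hom Phi.
  apply: dsum_map_hom => n; apply: dsum_map_hom => z.
  have [inj cov] := x_reps n.+1 z; have [hw _] := w_univ (K n.+1 z).
  exact: (component_hom (tau_par tau_rep z) inj cov hw).
have basis n z := group_cstar_basis (w_univ (K n z)).
exists (Phi \o f); split; last first.
  move=> g gG n z; rewrite /= fu // PhiE.
  have [inj cov] := x_reps n.+1 z.
  exact: (component_gen (tau_par tau_rep z) cov).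
apply: star_iso_comp => //; first by case: fiso.
split=> //; apply: injective_surjective_bijective => [a b ab|d].
- apply/eqP; rewrite -subr_eq0; apply/eqP.
  have {ab} : Phi (a - b) = 0 by rewrite (star_homB hPhi) ab subrr.
  move: (a - b) => c c0; apply: conv_ext => g t; rewrite ffunE.
  have [/(component_index_surj tau_rep x_reps)|/conv_out->//] := boolP (arrow (par_tuples G) (g, t)).
  move=> [n [z [i [j [h [hK ->]]]]]].
  have := PhiE c n z; rewrite c0 !ffunE => /matrixP/(_ i j); rewrite !mxE => /esym.
  by move/(proj2 (basis _ _)) => ->.
have coord (n : 'I_#|G|) z i j := proj1 (basis n.+1 z) (d n z i j).
have [F FE] := fin_all_exists (fun n => fin_all_exists (fun z =>
  fin_all_exists (fun i => fin_all_exists (fun j => coord n z i j)))).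
(* Each arrow occurs once in the enumeration, so the coefficients of the entries
   of d define a function on arrows, the preimage of d. *)
have /fin_all_exists[c cE] (p : gT * {set gT}) : exists c : R[i]%C,
    forall (n : 'I_#|G|) (z : orbit_type G n.+1) i j h,
      h \in lstab G (tau n.+1 z) -> p = component_index x z i j h -> c = F n z i j h.
  have [/(component_index_surj tau_rep x_reps)|np] := boolP (arrow (par_tuples G) p).
    move=> [n [z [i [j [h [hK ->]]]]]]; exists (F n z i j h) => n' z' i' j' h' hK'.
    exact: (component_index_inj tau_rep x_reps).
  exists 0 => n z i j h hK e; rewrite e in np.
  by rewrite (component_index_arrow tau_rep x_reps) in np.
exists (mk_conv (par_tuples_invariant G) (fun g t => c (g, t))).
apply/ffunP => n; apply/ffunP => z; rewrite PhiE; apply/matrixP => i j.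
rewrite mxE FE; apply: eq_bigr => h hK; congr (_ *: _); rewrite mk_convE.
rewrite (component_index_arrow tau_rep x_reps (z := z) i j hK).
exact: cE.
Qed.
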